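(* Let $\Omega\subset\mathbb{R}^N$ ($N\geq1$) be an open and bounded $BV$ extension domain, and let $u\in L^1(\Omega)$ and $\varepsilon>0$. Then there is a function $v\in BV(\Omega)$ with $\|u-v\|_1\le\varepsilon$ and $\mathrm{Var}\,v=(\varepsilon,1)\text{-}\mathrm{Var}\,u$.
   Context: Functions are real-valued and elements of $L^1(\Omega)$ are identified when they agree Lebesgue-almost everywhere; $\|\cdot\|_1$ is the $L^1(\Omega)$-norm. When $N=1$, $\Omega$ is assumed to be an interval. Variation: for $u\in L^1(\Omega)$, $\mathrm{Var}\,u:=\sup\{\int_\Omega u\,\mathrm{div}\,\varphi\,dx \mid \varphi\in[C_c^1(\Omega)]^N,\ \|\varphi\|_\infty\le 1\}\in[0,\infty]$, and $BV(\Omega):=\{u\in L^1(\Omega)\mid \mathrm{Var}\,u<\infty\}$, a Banach space with norm $\|u\|_{BV}=\|u\|_1+\mathrm{Var}\,u$. $BV$ extension domain (Ambrosio–Fusco–Pallara, Definition 3.20): an open set $\Omega\subset\mathbb{R}^N$ with bounded boundary such that for every open set $A\supset\overline{\Omega}$ and every $m\ge1$ there is a linear continuous extension operator $T:[BV(\Omega)]^m\to[BV(\mathbb{R}^N)]^m$ (so $Tu=u$ a.e. in $\Omega$) with: $Tu=0$ a.e. in $\mathbb{R}^N\setminus A$ for all $u\in[BV(\Omega)]^m$; $|D(Tu)|(\partial\Omega)=0$ for all $u\in[BV(\Omega)]^m$; and for every $q\in[1,\infty]$ the restriction of $T$ to $[W^{1,q}(\Omega)]^m$ is a linear continuous map into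 $[W^{1,q}(\mathbb{R}^N)]^m$. $(\varepsilon,1)$-variation: for $u\in L^1(\Omega)$ and $\varepsilon>0$, $(\varepsilon,1)\text{-}\mathrm{Var}\,u:=\inf\{\mathrm{Var}\,v\mid v\in BV(\Omega),\ \|u-v\|_1\le\varepsilon\}$, with the convention that the infimum over the empty set is $\infty$. *)

(* Defs.v *)
From HB Require Import structures.
From mathcomp Require Import all_boot all_order all_algebra.
From mathcomp Require Import all_classical all_reals all_analysis.
From mathcomp Require Import measurable_realfun.

Set Implicit Arguments.
Unset Strict Implicit.
Unset Printing Implicit Defensive.
Import Order.TTheory GRing.Theory Num.Theory.
Import numFieldNormedType.Exports.
Local Open Scope classical_set_scope.
Local Open Scope ring_scope.

Definition borel_mx_display : measure_display.
Proof. exact. Qed.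

Section borel_mx.
Variables (R : realType) (m n : nat).

Definition borel_mx : set (set 'M[R]_(m, n)) := <<s @open 'M[R]_(m, n) >>.

Lemma borel_mx0 : borel_mx set0.
Proof. exact: sigma_algebra0. Qed.

Lemma borel_mxC A : borel_mx A -> borel_mx (~` A).
Proof. exact: sigma_algebraC. Qed.

Lemma borel_mx_bigcup (F : (set 'M[R]_(m, n))^nat) :
  (forall i, borel_mx (F i)) -> borel_mx (\bigcup_i F i).
Proof. exact: sigma_algebra_bigcup. Qed.

HB.instance Definition _ := @isMeasurable.Build borel_mx_display
  'M[R]_(m, n) borel_mx borel_mx0 borel_mxC borel_mx_bigcup.

End borel_mx.

Section rV_measurability.
Variable R : realType.

Lemma open_measurable_rV n (A : set 'rV[R]_n) : open A -> measurable A.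
Proof. exact: sub_sigma_algebra. Qed.

Lemma measurable_fun_rV d (T : measurableType d) n (f : T -> 'rV[R]_n) :
  (forall i, measurable_fun setT (fun x => f x 0 i)) -> measurable_fun setT f.
Proof.
move=> mf; apply: (@measurability _ _ _ _ _ f (@open 'rV[R]_n)) => //.
move=> _ [U oU <-]; rewrite setTI.
pose B (p : 'rV[rat]_n * nat) : set 'rV[R]_n :=
  [set y | forall i, `|ratr (p.1 0 i) - y 0 i| < p.2.+1%:R^-1].
pose F p := if `[< B p `<=` U >] then f @^-1` B p else set0.
have -> : f @^-1` U = \bigcup_p F p.
  apply/seteqP; split => [x Ux|x [p _]]; last first.
    by rewrite /F; case: ifPn => // /asboolP BO; exact: BO.
  have /nbhs_ballP[e /= e0 eU] : nbhs (f x) U by exact: open_nbhs_nbhs.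
  have [k ke] : exists k : nat, k.+1%:R^-1 < e / 2.
    have [k _ /(_ k (leqnn k))] := near_infty_natSinv_lt (PosNum (divr_gt0 e0 (ltr0n R 2))).
    by move=> ?; exists k.
  have k0 : 0 < (k.+1%:R^-1 : R) by rewrite invr_gt0.
  have qP i : exists q : rat, `|ratr q - f x 0 i| < (k.+1%:R^-1 : R).
    have : f x 0 i - k.+1%:R^-1 < f x 0 i + k.+1%:R^-1.
      by rewrite ltrBlDr -addrA ltrDl addr_gt0.
    move=> /rat_in_itvoo[q]; rewrite in_itv /= => /andP[q1 q2]; exists q.
    by rewrite ltr_distl q1 q2.
  have [q qE] := choice qP.
  exists (\row_i q i, k) => //; rewrite /F; case: ifPn => [_|/asboolP[]].
    by move=> i /=; rewrite mxE.
  move=> y By; apply: eU => /=; split => // i j; rewrite (ord1 i) -ball_normE /=.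
  have := By j; rewrite /= mxE => yj.
  rewrite (_ : _ - _ = (f x 0 j - ratr (q j)) + (ratr (q j) - y 0 j)); last first.
    by rewrite addrA subrK.
  apply: (le_lt_trans (ler_normD _ _)); rewrite (splitr e) ltrD //.
    by rewrite distrC; exact: lt_trans (qE j) ke.
  exact: lt_trans ke.
apply: countable_bigcupT_measurable => [|p]; first exact: countableP.
rewrite /F; case: ifPn => // _.
have -> : f @^-1` B p = \bigcap_(i in [set: 'I_n])
    ((fun x => f x 0 i) @^-1`
      [set y | `|ratr (p.1 0 i) - y| < p.2.+1%:R^-1]).
  by apply/seteqP; split => x /= h i; [move=> _; exact: h|exact: h i I].
apply: fin_bigcap_measurable => // i _.
rewrite -[X in measurable X]setTI; apply: mf => //.
apply: open_measurable.
rewrite (_ : [set _ | _] = ball (ratr (p.1 0 i) : R) (p.2.+1%:R^-1)).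
  exact: ball_open.
by rewrite -ball_normE.
Qed.

Lemma measurable_coord n (i : 'I_n) :
  measurable_fun setT (fun x : 'rV[R]_n => x 0 i).
Proof.
apply: (measurability _ (RGenOpens.measurableE R)).
move=> _ [_ [a [b ->]] <-]; rewrite setTI; apply: open_measurable_rV.
by apply: open_comp => // x _; exact: coord_continuous.
Qed.

Definition cons_rV n (p : R * 'rV[R]_n) : 'rV[R]_n.+1 :=
  row_mx (const_mx p.1 : 'rV_1) p.2.

Definition uncons_rV n (x : 'rV[R]_n.+1) : R * 'rV[R]_n :=
  (x 0 ord0, \row_i x 0 (lift ord0 i)).

Lemma cons_rV0 n (p : R * 'rV[R]_n) : cons_rV p 0 ord0 = p.1.
Proof.
rewrite /cons_rV mxE; case: splitP => [j _|j /= /eqP//].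
by rewrite mxE.
Qed.

Lemma cons_rVS n (p : R * 'rV[R]_n) i : cons_rV p 0 (lift ord0 i) = p.2 0 i.
Proof.
rewrite /cons_rV mxE; case: splitP => [j|j] /=; rewrite /bump leq0n.
  by case: j => [[|//]].
by rewrite add1n => -[/val_inj ->].
Qed.

Lemma cons_rVK n : cancel (@cons_rV n) (@uncons_rV n).
Proof.
move=> p; rewrite /uncons_rV cons_rV0 (_ : \row__ _ = p.2); first by case: p.
by apply/rowP => i; rewrite mxE cons_rVS.
Qed.

Lemma uncons_rVK n : cancel (@uncons_rV n) (@cons_rV n).
Proof.
move=> x; apply/rowP => i; case: (unliftP ord0 i) => [j|] ->.
  by rewrite cons_rVS mxE.
by rewrite cons_rV0.
Qed.

Lemma measurable_cons_rV n : measurable_fun setT (@cons_rV n).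
Proof.
apply: measurable_fun_rV => i; case: (unliftP ord0 i) => [j|] ->.
  under eq_fun do rewrite cons_rVS.
  exact: (measurableT_comp (measurable_coord j) measurable_snd).
under eq_fun do rewrite cons_rV0.
exact: measurable_fst.
Qed.

Lemma measurable_uncons_rV n : measurable_fun setT (@uncons_rV n).
Proof.
apply: measurable_fun_pair; first exact: measurable_coord.
apply: measurable_fun_rV => i /=.
under eq_fun do rewrite mxE.
exact: (measurable_coord (lift ord0 i)).
Qed.

End rV_measurability.

Section lebesgue_step.
Local Open Scope ereal_scope.
Context (R : realType) (n : nat).
Variable mu : {sigma_finite_measure set 'rV[R]_n -> \bar R}.

Definition lebesgue_step : set 'rV[R]_n.+1 -> \bar R :=
  pushforward (lebesgue_measure \x mu) (@cons_rV R n).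

Let lebesgue_step0 : lebesgue_step set0 = 0.
Proof. by rewrite /lebesgue_step /pushforward preimage_set0 measure0. Qed.

Let lebesgue_step_ge0 A : 0 <= lebesgue_step A.
Proof. exact: (measure_ge0 (lebesgue_measure \x mu)). Qed.

Let lebesgue_step_sigma_additive : semi_sigma_additive lebesgue_step.
Proof.
move=> F mF tF mUF; rewrite /lebesgue_step /pushforward preimage_bigcup.
have mcons A : measurable A -> measurable (@cons_rV R n @^-1` A).
  by move=> mA; rewrite -[X in measurable X]setTI; exact: measurable_cons_rV.
apply: measure_semi_sigma_additive => [k||].
- exact: mcons.
- apply/trivIsetP => /= i j _ _ ij; rewrite -preimage_setI.
  by move/trivIsetP : tF => /(_ _ _ _ _ ij) ->//; rewrite preimage_set0.
- by rewrite -preimage_bigcup; exact: mcons.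
Qed.

HB.instance Definition _ := isMeasure.Build _ _ _ lebesgue_step
  lebesgue_step0 lebesgue_step_ge0 lebesgue_step_sigma_additive.

Let lebesgue_step_sigma_finite : sigma_finite setT lebesgue_step.
Proof.
have /sigma_finiteP[F [FT ndF Foo]] :=
  sigma_finiteT (@lebesgue_measure R : {sigma_finite_measure set _ -> \bar R}).
have /sigma_finiteP[G [GT ndG Goo]] := sigma_finiteT mu.
exists (fun k => @uncons_rV R n @^-1` (F k `*` G k)) => [|k].
  rewrite -preimage_bigcup; apply/seteqP; split => // x _ /=.
  have [i _ Fi] : (\bigcup_k F k) (uncons_rV x).1 by rewrite -FT.
  have [j _ Gj] : (\bigcup_k G k) (uncons_rV x).2 by rewrite -GT.
  exists (maxn i j) => //; split.
    by move: Fi; exact/subsetPset/ndF/leq_maxl.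
  by move: Gj; exact/subsetPset/ndG/leq_maxr.
have [mFk Fkoo] := Foo k; have [mGk Gkoo] := Goo k; split.
  rewrite -[X in measurable X]setTI; apply: measurable_uncons_rV => //.
  exact: measurableX.
rewrite /lebesgue_step /pushforward -comp_preimage.
rewrite (_ : _ \o _ = id); last by apply/funext => p /=; rewrite cons_rVK.
rewrite preimage_id product_measure1E//.
by rewrite lte_mul_pinfty// ge0_fin_numE.
Qed.

HB.instance Definition _ := Measure_isSigmaFinite.Build _ _ _ lebesgue_step
  lebesgue_step_sigma_finite.

End lebesgue_step.

Fixpoint lebesgue_rV (R : realType) (n : nat) :
    {sigma_finite_measure set 'rV[R]_n -> \bar R} :=
  if n is n'.+1 then lebesgue_step (lebesgue_rV R n') else \d_(0 : 'rV[R]_0).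

Lemma lebesgue_rV_box (R : realType) n (a b : 'I_n -> R) :
  (forall i, a i <= b i) ->
  lebesgue_rV R n [set x | forall i, a i <= x 0 i <= b i] =
  (\prod_i (b i - a i))%:E.
Proof.
elim: n a b => [|n IHn] a b ab /=.
  rewrite big_ord0 diracE (_ : _ \in _ = true) //.
  by apply/mem_set => -[].
pose B := [set x : 'rV[R]_n | forall i,
  a (lift ord0 i) <= x 0 i <= b (lift ord0 i)].
rewrite /lebesgue_step /pushforward.
rewrite (_ : _ @^-1` _ = `[a ord0, b ord0]%classic `*` B); last first.
  apply/seteqP; split => [p /= h|p [/= h0 hB] i].
    split => /=; first by have := h ord0; rewrite cons_rV0 in_itv.
    by move=> i; have := h (lift ord0 i); rewrite cons_rVS.
  case: (unliftP ord0 i) => [j|] ->; first by rewrite cons_rVS; exact: hB.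
  by rewrite cons_rV0; move: h0; rewrite in_itv.
rewrite product_measure1E //; last first.
  have -> : B = \bigcap_(i in [set: 'I_n]) ((fun x : 'rV[R]_n => x 0 i) @^-1`
      `[a (lift ord0 i), b (lift ord0 i)]%classic).
    apply/seteqP; split => [x h i _|x h i]; first by rewrite /= in_itv; exact: h.
    by have := h i I; rewrite /= in_itv.
  apply: fin_bigcap_measurable => // i _.
  by rewrite -[X in measurable X]setTI; exact: measurable_coord.
rewrite big_ord_recl EFinM -(IHn (a \o lift ord0) (b \o lift ord0)); last first.
  by move=> i; exact: ab.
congr (_ * _)%E; have /= -> := lebesgue_measure_itv `[a ord0, b ord0].
rewrite lte_fin -EFinB; case: ltP => // ba.
have -> : b ord0 = a ord0 by apply/eqP; rewrite eq_le ab ba.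
by rewrite subrr.
Qed.

Section definitions.
Variables (R : realType) (N : nat).
Local Notation E := 'rV[R]_N.
Local Notation mu := (lebesgue_rV R N).
Implicit Types Om A B : set E.

Definition partial (i : 'I_N) (f : E -> R) : E -> R := 'D_('e_i) f.

Definition C1 (f : E -> R) : Prop :=
  (forall x, differentiable f x) /\ forall i, continuous (partial i f).

Definition supp (f : E -> R) : set E := closure [set x | f x != 0].

(* Functions of C_c^1(Om), extended by 0 to the whole space. *)
Definition C1c Om (f : E -> R) : Prop :=
  [/\ C1 f, compact (supp f) & supp f `<=` Om].

Definition div (phi : 'I_N -> E -> R) (x : E) : R :=
  \sum_i partial i (phi i) x.

(* The norm of [E] in the library is the sup norm, hence this definition. *)
Definition enorm (I : finType) (a : I -> R) : R := Num.sqrt (\sum_i a i ^+ 2).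

(* Elements of function spaces on Om are represented by functions on the whole
   space, of which only the values on Om matter; equality is a.e. on Om. *)
Definition L1 Om (u : E -> R) : Prop := mu.-integrable Om (EFin \o u).

Definition norm1 Om (u : E -> R) : \bar R := (\int[mu]_(x in Om) `|u x|%:E)%E.

Definition Var Om (u : E -> R) : \bar R := ereal_sup
  [set (\int[mu]_(x in Om) (u x * div phi x)%:E)%E | phi in
    [set phi : 'I_N -> E -> R | (forall i, C1c Om (phi i)) /\
      forall x, Om x -> enorm (phi ^~ x) <= 1]].

Definition BV Om (u : E -> R) : Prop := L1 Om u /\ (Var Om u < +oo)%E.

Definition normBV Om (u : E -> R) : \bar R := (norm1 Om u + Var Om u)%E.

Definition eps1Var Om (eps : R) (u : E -> R) : \bar R := ereal_inf
  [set Var Om v | v in [set v | BV Om v /\ (norm1 Om (u \- v)%R <= eps%:E)%E]].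

Definition normq Om (q : \bar R) (u : E -> R) : \bar R :=
  'N[mu]_q[(EFin \o u) \_ Om]%E.

Definition Lq Om q (u : E -> R) : Prop :=
  measurable_fun Om u /\ (normq Om q u < +oo)%E.

Definition weak_partial Om (i : 'I_N) (u g : E -> R) : Prop :=
  forall phi, C1c Om phi ->
  (\int[mu]_(x in Om) (u x * partial i phi x)%:E =
   - \int[mu]_(x in Om) (g x * phi x)%:E)%E.

(* [u] is in W^{1,q}(Om), with weak partial derivatives [g i]. *)
Definition weak_gradient Om q (u : E -> R) (g : 'I_N -> E -> R) : Prop :=
  Lq Om q u /\ forall i, Lq Om q (g i) /\ weak_partial Om i u (g i).

Definition normW1q Om q (u : E -> R) (g : 'I_N -> E -> R) : \bar R :=
  (normq Om q u + \sum_i normq Om q (g i))%E.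

(* The charge [nu] is the i-th distributional derivative D_i w of w on the
   whole space; integration with respect to [nu] goes through its Jordan
   decomposition. *)
Definition derivative_charge (i : 'I_N) (w : E -> R)
    (nu : {charge set E -> \bar R}) : Prop :=
  forall phi, C1c setT phi ->
  forall P Q (nuPQ : hahn_decomposition nu P Q),
  (\int[mu]_x (w x * partial i phi x)%:E =
   - (\int[jordan_pos nuPQ]_x (phi x)%:E
      - \int[jordan_neg nuPQ]_x (phi x)%:E))%E.

(* Total variation |nu|(B) of a vector measure [nu] with components indexed
   by I, as a supremum over countable measurable partitions of B. *)
Definition total_variation (I : finType) (nu : I -> {charge set E -> \bar R})
    B : \bar R := ereal_sup
  [set (\sum_(0 <= k <oo) (enorm (fun i => fine (nu i (F k))))%:E)%E | F in
    [set F : (set E)^nat | [/\ forall k, measurable (F k), trivIset setT F &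
      \bigcup_k F k = B]]].

(* |Dw|(B) = 0, where Dw is the m x N matrix of measures D_i w_j. *)
Definition derivative_null m (w : 'I_m -> E -> R) B : Prop :=
  exists nu : 'I_m * 'I_N -> {charge set E -> \bar R},
    (forall j i, derivative_charge i (w j) (nu (j, i))) /\
    total_variation nu B = 0%E.

Definition boundary Om : set E := closure Om `\` interior Om.

Section extension.
Variables (m : nat) (Om : set E).
Implicit Types u v : 'I_m -> E -> R.

Definition BVm B u : Prop := forall j, BV B (u j).

Definition normBVm B u : \bar R := (\sum_j normBV B (u j))%E.

(* A linear continuous map from [BV(Om)]^m into [BV(R^N)]^m. Well-definedness
   on a.e. classes follows from a.e. linearity and boundedness. *)
Definition BVm_linear_continuous
    (T : ('I_m -> E -> R) -> 'I_m -> E -> R) : Prop :=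
  [/\ forall u, BVm Om u -> BVm setT (T u),
      forall (c : R) u v, BVm Om u -> BVm Om v -> forall j,
        {ae mu, forall x,
          T (fun k y => c * u k y + v k y) j x = c * T u j x + T v j x} &
      exists C : R, forall u, BVm Om u ->
        (normBVm setT (T u) <= C%:E * normBVm Om u)%E].

Definition W1qm_continuous (T : ('I_m -> E -> R) -> 'I_m -> E -> R)
    (q : \bar R) : Prop :=
  exists C : R, forall u (g : 'I_m -> 'I_N -> E -> R),
    (forall j, weak_gradient Om q (u j) (g j)) ->
    exists h : 'I_m -> 'I_N -> E -> R,
      (forall j, weak_gradient setT q (T u j) (h j)) /\
      (\sum_j normW1q setT q (T u j) (h j) <=
       C%:E * \sum_j normW1q Om q (u j) (g j))%E.

Definition extension_operator A
    (T : ('I_m -> E -> R) -> 'I_m -> E -> R) : Prop :=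
  [/\ BVm_linear_continuous T,
      forall u, BVm Om u -> forall j,
        {ae mu, forall x, Om x -> T u j x = u j x},
      forall u, BVm Om u -> forall j,
        {ae mu, forall x, ~ A x -> T u j x = 0},
      forall u, BVm Om u -> derivative_null (T u) (boundary Om) &
      forall q : \bar R, (1 <= q)%E -> W1qm_continuous T q].

End extension.

Definition BV_extension_domain Om : Prop :=
  [/\ open Om, bounded_set (boundary Om) &
    forall A, open A -> closure Om `<=` A ->
    forall m, (0 < m)%N ->
    exists T, @extension_operator m Om A T].

End definitions.

(* Main.v *)
(** Take a sequence in BV(Om) with [norm1 Om (u - v_k) <= eps] whose variations
    tend to the infimum; the infimum is finite because C_c^1(Om) is dense in
    L^1(Om).  It suffices to find a subsequence that converges in L^1_loc(Om)
    and almost everywhere: Fatou's lemma keeps the limit in the L^1 ball around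
    [u], and the test fields in the definition of the variation have compact
    support in Om, so the variation is lower semicontinuous.

    Local compactness comes from the estimate
    [int_B |v (x + z) - v x| dx <= C |z| Var v] on balls B well inside Om, proved
    by duality with C_c^1 functions.  It makes v close in L^1(B), uniformly
    along the sequence, to its average against a small Lipschitz kernel.  These
    averages are equibounded and equi-Lipschitz, hence Cauchy uniformly on B
    along an ultrafilter on the natural numbers, and so is (v_k) in L^1(B).  Using
    countably many balls that cover Om one picks a subsequence that is rapidly
    Cauchy on each of them, and which therefore converges almost everywhere. *)
From HB Require Import structures.
Require Import Defs.
From mathcomp Require Import finmap.
From mathcomp Require Import all_boot all_order all_algebra.
From mathcomp Require Import all_classical all_reals all_analysis.
From mathcomp Require Import measurable_realfun ring lra.
Import Order.TTheory GRing.Theory Num.Theory.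
Import numFieldNormedType.Exports.
Set Implicit Arguments.
Unset Strict Implicit.
Unset Printing Implicit Defensive.
Local Open Scope classical_set_scope.
Local Open Scope ring_scope.

(** * Translation invariance of the Lebesgue measure *)

(** A bound on the variation only bounds integrals of [v] against divergences of fields supported in
    [Om], so every estimate has to be turned into such a pairing. For increments, translation
    invariance moves the shift from [v] to the test function, and the derivative in the shift
    parameter falls on that function alone. The shifted field must stay supported in [Om]; this is
    why each ball comes with its double inside [Om]. No derivative reaches the averaging kernel: its
    Lipschitz bound controls the averages, and the increments control the distance to them, so a
    tent function is good enough. Duality needs a C^1 substitute for the sign that is bounded by 1
    and fixes 0. A sigmoid supplies it, and also turns sums of bumps into approximate indicators.
    Norm and balls are those of the sup norm: balls are cubes, bumps are products over the
    coordinates, and the Euclidean constraint on test fields costs a factor of the order of the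
    dimension. *)

Lemma lebesgue_measure_shift (R : realType) (a : R) (A : set R) :
  measurable A ->
  lebesgue_measure ((fun x => x + a) @^-1` A) = lebesgue_measure A.
Proof.
have mf : measurable_fun [set: measurableTypeR R]
    ((fun x => x + a) : R -> measurableTypeR R).
  exact: measurable_funD.
pose f : {mfun measurableTypeR R >-> measurableTypeR R} :=
  HB.pack ((fun x => x + a) : measurableTypeR R -> measurableTypeR R)
    (isMeasurableFun.Build _ _ _ _ _ mf).
move=> mA; apply/esym.
(* Lebesgue measure is determined by its values on half-open intervals, whose length the shift
   preserves. *)
rewrite (@lebesgue_measure_unique R (pushforward lebesgue_measure f))//.
move=> X [[x y]] xy <- /=; rewrite /pushforward.
rewrite (_ : _ @^-1` _ = `]x - a, y - a]%classic).
  by rewrite !lebesgue_measure_itv/= !lte_fin ltrD2r -!EFinB (_ : y - a - (x - a) = y - x)//; ring.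
by apply/seteqP; split => t /=; rewrite !in_itv/= ltrBlDr lerBrDr.
Qed.

Section measurable_translation.
Variables (R : realType) (n : nat).
Local Notation E := 'rV[R]_n.

Lemma measurable_add_rV :
  measurable_fun setT (fun p : E * E => p.1 + p.2).
Proof.
apply: measurable_fun_rV => i; under eq_fun do rewrite mxE.
apply: measurable_funD.
  exact: (measurableT_comp (measurable_coord i) measurable_fst).
exact: (measurableT_comp (measurable_coord i) measurable_snd).
Qed.

Lemma measurable_shift_rV (z : E) : measurable_fun setT (fun x : E => x + z).
Proof.
apply: measurable_fun_rV => i; under eq_fun do rewrite mxE.
by apply: measurable_funD => //; exact: measurable_coord.
Qed.

End measurable_translation.

(** Induction follows the recursive construction of the measure: through [cons_rV] a translation
    becomes a product of two translations, and the product measure is determined by its values on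
    rectangles. *)
Lemma lebesgue_rV_shift (R : realType) n (z : 'rV[R]_n) A : measurable A ->
  lebesgue_rV R n ((fun x => x + z) @^-1` A) = lebesgue_rV R n A.
Proof.
elim: n z A => [|n IHn] z A mA.
  by congr (lebesgue_rV R 0 _); rewrite thinmx0; apply/seteqP; split => x; rewrite /= addr0.
pose z' : 'rV[R]_n := \row_i z 0 (lift ord0 i).
have mtau : measurable_fun [set: measurableTypeR R * 'rV[R]_n]
    ((fun p => (p.1 + z 0 ord0, p.2 + z')) : measurableTypeR R * 'rV[R]_n -> measurableTypeR R * 'rV[R]_n).
  apply: measurable_fun_pair.
    by apply: measurable_funD => //; exact: measurable_fst.
  exact: (measurableT_comp (measurable_shift_rV z') measurable_snd).
pose tau : {mfun (measurableTypeR R * 'rV[R]_n)%type >-> (measurableTypeR R * 'rV[R]_n)%type} :=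
  HB.pack ((fun p => (p.1 + z 0 ord0, p.2 + z')) : measurableTypeR R * 'rV[R]_n -> measurableTypeR R * 'rV[R]_n)
    (isMeasurableFun.Build _ _ _ _ _ mtau).
have consD p : cons_rV p + z = cons_rV (tau p).
  apply/rowP => i; rewrite mxE; case: (unliftP ord0 i) => [j|] ->.
    by rewrite !cons_rVS /= !mxE.
  by rewrite !cons_rV0.
have -> : lebesgue_rV R n.+1 ((fun x => x + z) @^-1` A) =
    pushforward (lebesgue_measure \x lebesgue_rV R n)%E tau (@cons_rV R n @^-1` A).
  change ((lebesgue_measure \x lebesgue_rV R n)%E [set p | A (cons_rV p + z)] =
    (lebesgue_measure \x lebesgue_rV R n)%E [set p | A (cons_rV (tau p))]).
  congr (_ _); apply/funext => p; by rewrite /= consD.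
apply/esym.
apply: (@product_measure_unique _ _ _ _ _ lebesgue_measure (lebesgue_rV R n)
  (pushforward (lebesgue_measure \x lebesgue_rV R n)%E tau)).
  move=> B C mB mC.
  have mB' : measurable ((fun x : R => x + z 0 ord0) @^-1` B).
    rewrite -[X in measurable X]setTI.
    by apply: (_ : measurable_fun setT (fun x : R => x + z 0 ord0)) => //; exact: measurable_funD.
  have mC' : measurable ((fun x : 'rV[R]_n => x + z') @^-1` C).
    by rewrite -[X in measurable X]setTI; exact: measurable_shift_rV.
  have := @product_measure1E _ _ _ _ _ lebesgue_measure (lebesgue_rV R n) _ _ mB' mC'.
  move=> h; apply: (etrans h).
  by congr (_ * _)%E; [exact: lebesgue_measure_shift|exact: IHn].
by rewrite -[X in measurable X]setTI; exact: measurable_cons_rV.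
Qed.

Section lebesgue_rV_theory.
Variables (R : realType) (n : nat).
Local Notation E := 'rV[R]_n.
Local Notation mu := (lebesgue_rV R n).

Lemma ge0_integral_shift (z : E) (f : E -> \bar R) :
  measurable_fun setT f -> (forall x, 0 <= f x)%E ->
  (\int[mu]_x f (x + z)%R = \int[mu]_x f x)%E.
Proof.
move=> mf f0.
pose sh : {mfun E >-> E} := HB.pack (fun x : E => x + z)
  (isMeasurableFun.Build _ _ _ _ _ (measurable_shift_rV z)).
have := @ge0_integral_pushforward _ _ _ _ _ sh (measurable_shift_rV z) mu setT f
  measurableT mf (fun y _ => f0 y).
rewrite preimage_setT => <-.
by apply: eq_measure_integral => A mA _; exact: lebesgue_rV_shift.
Qed.

Lemma integral_shift (z : E) (f : E -> \bar R) : measurable_fun setT f ->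
  (\int[mu]_x f (x + z)%R = \int[mu]_x f x)%E.
Proof.
move=> mf; rewrite integralE [RHS]integralE; congr (_ - _)%E.
  rewrite -(ge0_integral_shift z (measurable_funepos mf)) => [|x].
    by apply: eq_integral => x _; rewrite !funeposE.
  exact: funepos_ge0.
rewrite -(ge0_integral_shift z (measurable_funeneg mf)) => [|x].
  by apply: eq_integral => x _; rewrite !funenegE.
exact: funeneg_ge0.
Qed.

Lemma Rintegral_shift (z : E) (f : E -> R) : measurable_fun setT f ->
  \int[mu]_x f (x + z) = \int[mu]_x f x.
Proof.
move=> mf; congr fine.
rewrite -(integral_shift z (f := EFin \o f))//.
exact/measurable_EFinP.
Qed.

Lemma coord_le_norm (x : E) i : `|x 0 i| <= `|x|.
Proof.
have: mx_norm x <= `|x| by [].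
by rewrite mx_normrE => /bigmax_leP[_ /(_ (0, i) isT)].
Qed.

Lemma measurable_box (a b : 'I_n -> R) :
  measurable [set x : E | forall i, a i <= x 0 i <= b i].
Proof.
rewrite (_ : [set _ | _] = \bigcap_(i in [set: 'I_n]) ((fun x : E => x 0 i) @^-1`
    `[a i, b i]%classic)); last first.
  apply/seteqP; split => [x h i _|x h i]; first by rewrite /= in_itv; exact: h.
  by have := h i I; rewrite /= in_itv.
apply: fin_bigcap_measurable => // i _.
by rewrite -[X in measurable X]setTI; exact: measurable_coord.
Qed.

Lemma lebesgue_rV_bounded (A : set E) : measurable A -> bounded_set A ->
  (mu A < +oo)%E.
Proof.
move=> mA [M [_ /(_ (`|M| + 1))]].
have M1 : M < `|M| + 1 by rewrite (le_lt_trans (ler_norm _))// ltrDl.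
move=> /(_ M1) AM; have M0 : 0 <= `|M| + 1 by rewrite addr_ge0.
pose B := [set x : E | forall i, (fun=> - (`|M| + 1)) i <= x 0 i <= (fun=> `|M| + 1) i].
have mB : measurable B by exact: measurable_box.
apply: (@le_lt_trans _ _ (mu B)); last first.
  by rewrite /B lebesgue_rV_box ?ltry// => i; rewrite ge0_cp.
apply: le_measure; rewrite ?inE// => x Ax i.
by rewrite -ler_norml (le_trans (coord_le_norm _ _) (AM _ Ax)).
Qed.

(** Balls of the sup norm are open cubes. The condition [0 < r] matters in dimension 0, where the
    right-hand side is vacuous. *)
Lemma ball_rV (c x : E) (r : R) : 0 < r ->
  ball c r x <-> forall i, `|c 0 i - x 0 i| < r.
Proof.
move=> r0; split.
  by rewrite /ball /= => -[_ h] i; have := h 0 i; rewrite -ball_normE.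
move=> h; rewrite /ball /=; split => // i j.
by rewrite (ord1 i) -ball_normE /=; exact: h.
Qed.

Lemma measurable_ball_rV (c : E) (r : R) : measurable (ball c r).
Proof.
exact: (open_measurable_rV (@ball_open _ _ c r)).
Qed.

Lemma bounded_ball_rV (c : E) (r : R) : bounded_set (ball c r).
Proof.
exists (`|c| + r); split; first by rewrite num_real.
move=> M cM x; rewrite -ball_normE /= => cx; apply: le_trans (ltW cM).
by rewrite -[x](subKr c) (le_trans (ler_normB _ _))// lerD2l ltW.
Qed.

Lemma lebesgue_rV_ball_gt0 (c : E) (r : R) : 0 < r -> (0 < mu (ball c r))%E.
Proof.
move=> r0.
pose B := [set x : E | forall i, (fun i => c 0 i - r / 2) i <= x 0 i <= (fun i => c 0 i + r / 2) i].
have mB : measurable B by exact: measurable_box.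
apply: (@lt_le_trans _ _ (mu B)).
  rewrite /B lebesgue_rV_box; last by move=> i; lra.
  by rewrite lte_fin; apply: prodr_gt0 => i _; lra.
apply: le_measure; rewrite ?inE//; first exact: measurable_ball_rV.
by move=> x Bx; apply/ball_rV => // i; have := Bx i; rewrite ltr_distlC; lra.
Qed.

End lebesgue_rV_theory.

(** * Functions of class C^1 *)

Section C1_theory.
Variables (R : realType) (n : nat).
Local Notation E := 'rV[R]_n.
Implicit Types (f g : E -> R) (c : R) (psi : R -> R).

Lemma C1_continuous f : C1 f -> continuous f.
Proof. by move=> [df _] x; exact: differentiable_continuous. Qed.

Lemma derive_partial f x z : differentiable f x ->
  'D_z f x = \sum_i z 0 i * partial i f x.
Proof.
move=> df; rewrite deriveE// {1}[z]row_sum_delta linear_sum.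
by apply: eq_bigr => i _; rewrite linearZ /partial deriveE.
Qed.

Lemma C1_cst c : C1 (cst c : E -> R).
Proof.
split=> [x|i]; first exact: differentiable_cst.
rewrite (_ : partial _ _ = cst 0); first exact: cst_continuous.
by apply/funext => x; rewrite /partial derive_cst.
Qed.

Lemma C1_coord i : C1 (fun x : E => x 0 i).
Proof.
split=> [x|j]; first exact: (@differentiable_coord R 1 n x 0 i).
rewrite (_ : partial _ _ = cst (('e_j : E) 0 i)); first exact: cst_continuous.
apply/funext => x; apply: (@cvg_lim R^o) => //; apply: cvg_near_cst; near=> h.
rewrite (_ : (_ \o _) _ = (h *: ('e_j : E) + x) 0 i)// mxE addrK mxE [LHS]mulKf//.
by near: h; exact: nbhs_dnbhs_neq.
Unshelve. all: by end_near. Qed.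

Lemma partialD f g i : C1 f -> C1 g ->
  partial i (f \+ g) = partial i f \+ partial i g.
Proof.
move=> [df _] [dg _]; apply/funext => x; rewrite /partial.
by rewrite (@deriveD _ _ _ f g) //; exact: diff_derivable.
Qed.

Lemma partialM f g i : C1 f -> C1 g ->
  partial i (f \* g) = (f \* partial i g) \+ (g \* partial i f).
Proof.
move=> [df _] [dg _]; apply/funext => x; rewrite /partial.
by rewrite (@deriveM _ _ f g) //; exact: diff_derivable.
Qed.

Lemma C1D f g : C1 f -> C1 g -> C1 (f \+ g).
Proof.
move=> Cf Cg; split=> [x|i]; first by apply: differentiableD; [exact: Cf.1|exact: Cg.1].
by rewrite partialD// => x; apply: continuousD; [exact: Cf.2|exact: Cg.2].
Qed.

Lemma C1M f g : C1 f -> C1 g -> C1 (f \* g).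
Proof.
move=> Cf Cg; split=> [x|i]; first by apply: differentiableM; [exact: Cf.1|exact: Cg.1].
rewrite partialM// => x.
have cf : {for x, continuous f} by exact: C1_continuous.
have cg : {for x, continuous g} by exact: C1_continuous.
have cf' := Cf.2 i x; have cg' := Cg.2 i x.
have h1 : {for x, continuous (f \* partial i g)} by exact: (cvgM cf cg').
have h2 : {for x, continuous (g \* partial i f)} by exact: (cvgM cg cf').
exact: (cvgD h1 h2).
Qed.

Lemma partial_comp psi f i : (forall t, derivable psi t 1) -> C1 f ->
  partial i (psi \o f) = ((derive1 psi) \o f) \* partial i f.
Proof.
move=> dpsi [df _]; apply/funext => x /=.
have dp t : differentiable psi t by apply/derivable1_diffP.
rewrite /partial deriveE; last exact: differentiable_comp.
rewrite diff_comp//= deriveE// deriv1E//=.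
by rewrite /GRing.scale/= mulrC.
Qed.

Lemma C1_comp psi f : (forall t, derivable psi t 1) -> continuous (derive1 psi) ->
  C1 f -> C1 (psi \o f).
Proof.
move=> dpsi cpsi Cf; split=> [x|i].
  by apply: differentiable_comp; [exact: Cf.1|apply/derivable1_diffP].
rewrite partial_comp// => x; have cf' := Cf.2 i x.
have h1 : {for x, continuous ((derive1 psi) \o f)}.
  by apply: continuous_comp; [exact: C1_continuous|exact: cpsi].
exact: (cvgM h1 cf').
Qed.

Lemma partial_shift f z i :
  partial i (fun x => f (x + z)) = (fun x => partial i f (x + z)).
Proof.
apply/funext => x; rewrite /partial /derive.
rewrite (_ : (fun h => _) = (fun h : R =>
    h^-1 *: ((f \o shift (x + z)) (h *: ('e_i : E)) - f (x + z))))//.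
by apply/funext => h /=; rewrite addrA.
Qed.

Lemma C1_shift f z : C1 f -> C1 (fun x => f (x + z)).
Proof.
move=> Cf; split=> [x|i].
  apply: (@differentiable_comp _ _ _ _ (fun x : E => x + z) f); last exact: Cf.1.
  by apply: differentiableD => //; exact: differentiable_cst.
rewrite partial_shift => x.
apply: (@continuous_comp _ _ _ (fun x : E => x + z) (partial i f)); last exact: Cf.2.
by apply: continuousD => //; exact: cst_continuous.
Qed.

Lemma C1_sum I (s : seq I) (F : I -> E -> R) : (forall i, C1 (F i)) ->
  C1 (fun x => \sum_(i <- s) F i x).
Proof.
move=> CF; elim: s => [|a s IHs].
  rewrite (_ : (fun _ => _) = cst 0); first exact: C1_cst.
  by apply/funext => x; rewrite big_nil.
rewrite (_ : (fun _ => _) = F a \+ (fun x => \sum_(i <- s) F i x)).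
  exact: C1D.
by apply/funext => x; rewrite big_cons.
Qed.

Lemma C1_prod I (s : seq I) (F : I -> E -> R) : (forall i, C1 (F i)) ->
  C1 (fun x => \prod_(i <- s) F i x).
Proof.
move=> CF; elim: s => [|a s IHs].
  rewrite (_ : (fun _ => _) = cst 1); first exact: C1_cst.
  by apply/funext => x; rewrite big_nil.
rewrite (_ : (fun _ => _) = F a \* (fun x => \prod_(i <- s) F i x)).
  exact: C1M.
by apply/funext => x; rewrite big_cons.
Qed.
End C1_theory.

(** * One-variable profiles: the squared positive part and the sigmoid *)

Section smooth_functions.
Variable R : realType.
Implicit Types (s t k : R) (psi : R -> R).

(** A quadratic bound on the remainder replaces one-sided limits, so that a function defined by
    cases such as [sqpos] only needs sign distinctions and polynomial inequalities. *)
Lemma is_derive_quadratic_remainder psi s (d : R) :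
  (forall h, `|psi (h + s) - psi s - d * h| <= h ^+ 2) -> is_derive s 1 psi d.
Proof.
move=> H.
have L : (fun h => h^-1 *: ((psi \o shift s) (h *: (1 : R)) - psi s)) @ 0^' --> d.
  apply/cvgrPdist_lt => e e0; near=> h.
  have h0 : h != 0 by near: h; exact: nbhs_dnbhs_neq.
  have he : `|h| < e by near: h; apply: dnbhs0_lt.
  apply: le_lt_trans he; rewrite /= /GRing.scale/= mulr1.
  rewrite distrC (_ : _ - d = h^-1 * (psi (h + s) - psi s - d * h)); last by field.
  rewrite normrM normfV ler_pdivrMl ?normr_gt0// -expr2 real_normK ?num_real//.
split; first by apply/cvg_ex; exists d.
exact: cvg_lim L.
Unshelve. all: by end_near. Qed.

(** Squaring makes the positive part C^1 and keeps its zero set. *)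
Definition sqpos t : R := Num.max t 0 ^+ 2.

Lemma is_derive_sqpos s : is_derive s 1 sqpos (2 * Num.max s 0).
Proof.
apply: is_derive_quadratic_remainder => h; rewrite /sqpos ler_norml.
by case: (leP s 0) => s0; case: (leP (h + s) 0) => hs0; apply/andP; split; nra.
Qed.

Lemma derivable_sqpos s : derivable sqpos s 1.
Proof. by have [] := is_derive_sqpos s. Qed.

Lemma continuous_derive_sqpos : continuous (derive1 sqpos).
Proof.
rewrite (_ : (derive1 sqpos) = fun s => 2 * Num.max s 0).
  move=> s; have h : {for s, continuous (fun t : R => Num.max t 0)}.
    by apply: (@continuous_max _ _ id (cst 0)) => //; exact: cst_continuous.
  have h2 : {for s, continuous (cst 2 : R -> R)} by exact: cst_continuous.
  have h3 : {for s, continuous (cst 2 \* (fun t : R => Num.max t 0))}.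
    exact: (cvgM h2 h).
  exact: h3.
by apply/funext => s; rewrite derive1E; have [] := is_derive_sqpos s.
Qed.

Lemma sqpos_ge0 s : 0 <= sqpos s. Proof. exact: sqr_ge0. Qed.

Lemma sqpos_eq0 s : (sqpos s == 0) = (s <= 0).
Proof. by rewrite /sqpos sqrf_eq0; case: leP => [|s0]; rewrite ?eqxx// gt_eqF. Qed.

(** This is tanh(k t / 2). It fixes 0, so composing with it does not enlarge supports; it is bounded
    by 1 and tends to the sign of [t] as [k] grows. *)
Definition sigmoid k t : R := 1 - 2 * (1 + expR (k * t))^-1.

Lemma is_derive_sigmoid k s : is_derive s 1 (sigmoid k)
  (2 * k * expR (k * s) * ((1 + expR (k * s)) ^- 2)).
Proof.
have d1 : is_derive s 1 (fun t => k * t) k.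
  have -> : (fun t => k * t) = k \*: id by [].
  by apply: is_derive_eq; rewrite /GRing.scale/= mulr1.
have d2 : is_derive s 1 (fun t => expR (k * t)) (expR (k * s) * k).
  exact: (@is_derive1_comp _ expR (fun t => k * t)).
pose e t := expR (k * t).
have d3 : is_derive s 1 (cst 1 + e) (0 + expR (k * s) * k).
  exact: is_deriveD.
have n0 : (cst 1 + e) s != 0 by rewrite gt_eqF// addr_gt0// expR_gt0.
have d4 := is_deriveV n0 d3.
have d5 := is_deriveB (is_derive_cst (1 : R) s 1) (is_deriveZ 2 d4).
apply: (is_derive_eq d5).
have -> : (cst 1 + e) s = 1 + expR (k * s) by [].
have {}n0 : 1 + expR (k * s) != 0 by [].
rewrite /GRing.scale/=.
by field.
Qed.

Lemma derivable_sigmoid k s : derivable (sigmoid k) s 1.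
Proof. by have [] := is_derive_sigmoid k s. Qed.

Lemma continuous_derive_sigmoid k : continuous (derive1 (sigmoid k)).
Proof.
rewrite (_ : (derive1 (sigmoid k)) =
    fun s => 2 * k * expR (k * s) * ((1 + expR (k * s)) ^- 2)); last first.
  by apply/funext => s; rewrite derive1E; have [] := is_derive_sigmoid k s.
move=> s.
have ce : {for s, continuous (fun t => expR (k * t))}.
  apply: (@continuous_comp _ _ _ (fun t => k * t) expR); last exact: continuous_expR.
  exact: mulrl_continuous.
have cc c : {for s, continuous (cst c : R -> R)} by exact: cst_continuous.
pose e t := expR (k * t).
have ce1 : {for s, continuous (cst 1 \+ e)} by exact: (cvgD (cc 1) ce).
have ce2 : {for s, continuous ((cst 1 \+ e) \* (cst 1 \+ e))} by exact: cvgM.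
have ce3 : {for s, continuous (fun t => (((cst 1 \+ e) \* (cst 1 \+ e)) t)^-1)}.
  by apply: cvgV => //=; rewrite mulf_neq0// gt_eqF// addr_gt0// expR_gt0.
have ce4 : {for s, continuous (cst (2 * k) \* e)} by exact: (cvgM (cc _) ce).
exact: (cvgM ce4 ce3).
Qed.

Lemma sigmoid0 k : sigmoid k 0 = 0.
Proof. by rewrite /sigmoid mulr0 expR0; field. Qed.

Lemma sigmoid_norm_le1 k t : `|sigmoid k t| <= 1.
Proof.
have e0 := expR_gt0 (k * t); rewrite /sigmoid ler_norml.
have : 0 < (1 + expR (k * t))^-1 < 1.
  by rewrite invr_gt0 invf_lt1; lra.
lra.
Qed.

Lemma sigmoidN k t : sigmoid k (- t) = - sigmoid k t.
Proof.
rewrite /sigmoid mulrN expRN; have := expR_gt0 (k * t).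
by move=> h; field; rewrite !gt_eqF//; lra.
Qed.

Lemma sigmoid_ge k t : 0 < k -> 0 < t -> 1 - 2 / (k * t) <= sigmoid k t.
Proof.
move=> k0 t0; rewrite /sigmoid lerD2l lerN2 ler_pM2l// lef_pV2 ?posrE.
- by have := expR_ge1Dx (k * t); lra.
- by rewrite addr_gt0// expR_gt0.
- exact: mulr_gt0.
Qed.

(** Measures how well the sigmoid replaces the sign: the loss [2 / k] does not depend on [t], so
    integration only multiplies it by the measure of the domain. Both sides are even in [t]. *)
Lemma mul_sigmoid_ge k t : 0 < k -> `|t| - 2 / k <= t * sigmoid k t.
Proof.
move=> k0; wlog t0 : t / 0 <= t.
  move=> H; have [/H//|t0] := leP 0 t.
  by have := H (- t); rewrite normrN sigmoidN mulrNN oppr_ge0; apply; exact: ltW.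
move: t0; rewrite le_eqVlt => /orP[/eqP<-|t0].
  by rewrite normr0 mul0r sub0r oppr_le0 divr_ge0// ltW.
rewrite gtr0_norm//; have := sigmoid_ge k0 t0.
rewrite -(ler_pM2l t0); apply: le_trans.
rewrite le_eqVlt; apply/orP; left; apply/eqP.
by field; rewrite !gt_eqF.
Qed.

End smooth_functions.

(** * Test functions with compact support *)

Section C1c_theory.
Variables (R : realType) (n : nat).
Local Notation E := 'rV[R]_n.
Local Notation mu := (lebesgue_rV R n).
Implicit Types (f g : E -> R) (Om U K : set E).

Lemma continuous_measurable_rV f : continuous f -> measurable_fun setT f.
Proof.
move=> cf; apply: (measurability _ (RGenOpens.measurableE R)).
move=> _ [_ [a [b ->]] <-]; rewrite setTI; apply: open_measurable_rV.
by apply: open_comp => // x _; exact: cf.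
Qed.

Lemma hausdorff_rV : hausdorff_space E.
Proof. exact: norm_hausdorff. Qed.

(** A compact set is closed here, so it contains the support as soon as it contains the points where
    [f] is nonzero; no closure has to be computed. *)
Lemma C1cI Om K f : C1 f -> compact K -> K `<=` Om ->
  (forall x, f x != 0 -> K x) -> C1c Om f.
Proof.
move=> Cf cK KOm fK.
have sK : supp f `<=` K.
  by rewrite [X in _ `<=` X](closure_id _).1; [exact: closureS|exact: (compact_closed hausdorff_rV)].
split=> //; last exact: subset_trans KOm.
apply: subclosed_compact cK sK; exact: closed_closure.
Qed.

Lemma supp_neq0 f x : f x != 0 -> supp f x.
Proof. by move=> fx; apply: subset_closure. Qed.

Lemma notin_supp f x : ~ supp f x -> f x = 0.
Proof. by move=> nx; apply/eqP; apply: contra_notT nx; exact: supp_neq0. Qed.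

Lemma C1c_cst0 Om : C1c Om (cst 0 : E -> R).
Proof.
apply: (@C1cI _ set0) => //=; [exact: C1_cst|exact: compact0|].
by move=> x; rewrite eqxx.
Qed.

Lemma C1c_sub Om U f : Om `<=` U -> C1c Om f -> C1c U f.
Proof. by move=> OU [Cf cf sf]; split=> //; exact: subset_trans OU. Qed.

Lemma C1c_of_C1 Om f g : C1 f -> C1c Om g -> (forall x, f x != 0 -> g x != 0) ->
  C1c Om f.
Proof.
move=> Cf [Cg cg sg] fg; apply: (C1cI Cf cg sg) => x /fg; exact: supp_neq0.
Qed.

Lemma C1c_mulr Om f g : C1 f -> C1c Om g -> C1c Om (f \* g).
Proof.
move=> Cf Cg; apply: (C1c_of_C1 _ Cg); first by apply: C1M => //; case: Cg.
by move=> x /=; apply: contra_neq => ->; rewrite mulr0.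
Qed.

Lemma C1c_comp Om (psi : R -> R) f : (forall t, derivable psi t 1) ->
  continuous (derive1 psi) -> psi 0 = 0 -> C1c Om f -> C1c Om (psi \o f).
Proof.
move=> dp cp p0 Cf; apply: (C1c_of_C1 _ Cf); first by apply: C1_comp => //; case: Cf.
by move=> x /=; apply: contra_neq => ->.
Qed.

Lemma C1c_sum Om (I : Type) (s : seq I) (F : I -> E -> R) :
  (forall i, C1c Om (F i)) -> C1c Om (fun x => \sum_(i <- s) F i x).
Proof.
move=> CF; have CsF t : C1 (fun x => \sum_(i <- t) F i x).
  by apply: C1_sum => i; case: (CF i).
apply: (@C1cI _ (\big[setU/set0]_(i <- s) supp (F i))) => //.
- by apply: bigsetU_compact => i _; case: (CF i).
- elim: s => [|a s IHs]; first by rewrite big_nil.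
  by rewrite big_cons => x [|/IHs//]; case: (CF a) => _ _; apply.
- move=> x; elim: s => [|a s IHs]; first by rewrite !big_nil eqxx.
  rewrite !big_cons; have [->|/supp_neq0] := eqVneq (F a x) 0; last by left.
  by rewrite add0r => /IHs; right.
Qed.

Lemma C1cD Om f g : C1c Om f -> C1c Om g -> C1c Om (f \+ g).
Proof.
move=> Cf Cg; apply: (@C1cI _ (supp f `|` supp g)).
- by apply: C1D; [case: Cf|case: Cg].
- by apply: compactU; [case: Cf|case: Cg].
- by move=> x []; [case: Cf => _ _; apply|case: Cg => _ _; apply].
- move=> x /=; have [->|/supp_neq0] := eqVneq (f x) 0; last by left.
  by rewrite add0r => /supp_neq0; right.
Qed.

Lemma continuous_shift_rV (z : E) : continuous (fun x : E => x + z).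
Proof.
move=> x.
have cc : {for x, continuous (cst z : E -> E)} by exact: cst_continuous.
have ci : {for x, continuous (id : E -> E)} by [].
exact: (cvgD ci cc).
Qed.

Lemma C1c_shift Om U f z : C1c Om f -> (forall x, Om (x + z) -> U x) ->
  C1c U (fun x => f (x + z)).
Proof.
move=> [Cf cf sf] OU.
apply: (@C1cI _ ((fun x => x - z) @` supp f)).
- exact: C1_shift.
- apply: continuous_compact => //; apply: continuous_subspaceT.
  exact: continuous_shift_rV.
- by move=> _ [x /sf xs <-]; apply: OU; rewrite subrK.
- move=> x /supp_neq0 fx; exists (x + z) => //; exact: addrK.
Qed.

Lemma partial_notin_supp f i x : ~ supp f x -> partial i f x = 0.
Proof.
move=> nx; rewrite /partial (@near_eq_derive _ _ _ f (cst 0)) ?derive_cst//.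
have : open_nbhs x (~` supp f) by split => //; apply: closed_openC; exact: closed_closure.
by move=> /open_nbhs_nbhs; apply: filterS => y; exact: notin_supp.
Qed.

Lemma compact_supp_bounded f K : compact K -> continuous f ->
  (forall x, ~ K x -> f x = 0) -> exists2 M, 0 <= M & forall x, `|f x| <= M.
Proof.
move=> cK cf f0.
have /compact_bounded[M [_ HM]] : compact (f @` K).
  by apply: continuous_compact => //; exact: continuous_subspaceT.
exists (`|M| + 1) => [|x]; first by rewrite addr_ge0.
have [Kx|/f0->] := pselect (K x); last by rewrite normr0 addr_ge0.
apply: HM; last by exists x.
by rewrite (le_lt_trans (ler_norm _))// ltrDl.
Qed.

Lemma C1c_bounded Om f : C1c Om f -> exists2 M, 0 <= M & forall x, `|f x| <= M.
Proof.
move=> [Cf cf _]; apply: (compact_supp_bounded cf); last by move=> x; exact: notin_supp.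
exact: C1_continuous.
Qed.

Lemma C1c_partial_bounded Om f i : C1c Om f ->
  exists2 M, 0 <= M & forall x, `|partial i f x| <= M.
Proof.
move=> [Cf cf _]; apply: (compact_supp_bounded cf); last by move=> x; exact: partial_notin_supp.
exact: Cf.2.
Qed.

Lemma C1c_measurable Om f : C1c Om f -> measurable_fun setT f.
Proof. by move=> [Cf _ _]; apply: continuous_measurable_rV; exact: C1_continuous. Qed.

Lemma C1c_partial_measurable Om f i : C1c Om f -> measurable_fun setT (partial i f).
Proof. by move=> [Cf _ _]; apply: continuous_measurable_rV; exact: Cf.2. Qed.

(** A product over the coordinates because balls are cubes: one factor vanishes as soon as one
    coordinate leaves its interval. *)
Definition ball_bump (c : E) (r : R) (x : E) : R :=
  \prod_i sqpos (r ^+ 2 - (x 0 i - c 0 i) ^+ 2).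

Lemma ball_bump_ge0 c r x : 0 <= ball_bump c r x.
Proof.
by rewrite /ball_bump; elim/big_ind : _ => [||i _]; [exact: ler01|exact: mulr_ge0|exact: sqpos_ge0].
Qed.

Lemma ball_bump_neq0 c r x : 0 < r -> ball_bump c r x != 0 <-> ball c r x.
Proof.
move=> r0; rewrite ball_rV//; split.
  move=> /prodf_neq0 h i; have := h i isT; rewrite sqpos_eq0 -ltNge subr_gt0.
  by rewrite distrC -[ltLHS]real_normK ?num_real// ltr_pXn2r ?nnegrE// ltW.
move=> h; apply/prodf_neq0 => i _; have := h i.
rewrite sqpos_eq0 -ltNge subr_gt0 distrC => hi.
by rewrite -[ltLHS]real_normK ?num_real// ltr_pXn2r ?nnegrE// ltW.
Qed.

Lemma C1_ball_bump c r : C1 (ball_bump c r).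
Proof.
apply: C1_prod => i.
have C1x : C1 (fun x : E => x 0 i - c 0 i).
  rewrite (_ : (fun x => _) = (fun x : E => x 0 i) \+ cst (- c 0 i))//.
  by apply: C1D; [exact: C1_coord|exact: C1_cst].
have C1r : C1 (fun x : E => r ^+ 2 - (x 0 i - c 0 i) ^+ 2).
  rewrite (_ : (fun x => _) = cst (r ^+ 2) \+ (cst (-1) \*
      ((fun x : E => x 0 i - c 0 i) \* (fun x : E => x 0 i - c 0 i)))); last first.
    by apply/funext => x /=; rewrite mulN1r -expr2.
  by apply: C1D; [exact: C1_cst|apply: C1M; [exact: C1_cst|exact: C1M]].
apply: (C1_comp (psi := @sqpos R)) => //.
  exact: derivable_sqpos.
exact: continuous_derive_sqpos.
Qed.

Lemma closed_ball_compact_rV (c : E) (r : R) : compact [set x | `|x - c| <= r].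
Proof.
apply: bounded_closed_compact.
  exists (`|c| + r); split; first by rewrite num_real.
  move=> M cM x /= cx; apply: le_trans (ltW cM).
  by rewrite -[x](subrK c) addrC (le_trans (ler_normD _ _))// lerD2l.
rewrite (_ : [set _ | _] = (fun x => `|x - c|) @^-1` [set t | t <= r])//.
apply: closed_comp; last exact: closed_le.
move=> x _; apply: (@continuous_comp _ _ _ (fun x : E => x - c) (fun x : E => `|x|)).
  exact: continuous_shift_rV.
exact: norm_continuous.
Qed.

Lemma C1c_ball_bump Om c r r' : 0 < r < r' -> ball c r' `<=` Om -> C1c Om (ball_bump c r).
Proof.
move=> /andP[r0 rr'] cOm; apply: (@C1cI _ [set x | `|x - c| <= r]).
- exact: C1_ball_bump.
- exact: closed_ball_compact_rV.
- by move=> x /= cx; apply: cOm; rewrite -ball_normE /= distrC (le_lt_trans cx).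
- by move=> x /ball_bump_neq0-/(_ r0); rewrite -ball_normE /= distrC => /ltW.
Qed.

(** A countable family of balls; the factor [k] enlarges a ball about its own centre. The value 1
    gives the ball itself and 2 the double that must fit in an open set. *)
Definition rat_ball (k : R) (p : 'rV[rat]_n * nat) : set E :=
  ball (map_mx ratr p.1 : E) (k * p.2.+1%:R^-1).

Lemma rat_ball_nbhs U x (k : R) : open U -> U x -> 0 < k ->
  exists p, rat_ball 1 p x /\ rat_ball k p `<=` U.
Proof.
move=> oU Ux k0.
have /nbhs_ballP[e /= e0 eU] : nbhs x U by exact: open_nbhs_nbhs.
(* The enlarged ball has radius [k / (m + 1)] and a centre within [1 / (m + 1)] of [x], so
   [(k + 1) / (m + 1) < e] keeps it inside the [e]-ball. *)
have e1 : 0 < e / (k + 1) by rewrite divr_gt0// addr_gt0.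
have [m me] : exists m : nat, m.+1%:R^-1 < e / (k + 1).
  have [m _ /(_ m (leqnn m))] := near_infty_natSinv_lt (PosNum e1).
  by move=> ?; exists m.
have m0 : 0 < (m.+1%:R^-1 : R) by rewrite invr_gt0.
have qP i : exists q : rat, `|ratr q - x 0 i| < (m.+1%:R^-1 : R).
  have : x 0 i - m.+1%:R^-1 < x 0 i + m.+1%:R^-1.
    by rewrite ltrBlDr -addrA ltrDl addr_gt0.
  move=> /rat_in_itvoo[q]; rewrite in_itv /= => /andP[q1 q2]; exists q.
  by rewrite ltr_distl q1 q2.
have [q qE] := choice qP.
exists (\row_i q i, m).
have xq : rat_ball 1 (\row_i q i, m) x.
  by apply/ball_rV; rewrite mul1r//= => i; rewrite !mxE.
split=> // y; rewrite /rat_ball /= => qy; apply: eU.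
apply: (@le_ball _ _ _ (m.+1%:R^-1 + k * m.+1%:R^-1)).
  move: me; rewrite ltr_pdivlMr ?addr_gt0// => /ltW; apply: le_trans.
  by rewrite mulrDr mulr1 addrC mulrC.
apply: ball_triangle qy; apply: ball_sym.
by move: xq; rewrite /rat_ball mul1r.
Qed.

End C1c_theory.

(** * Density of C_c^1 in L^1 *)

Section norm1_theory.
Variables (R : realType) (n : nat).
Local Notation E := 'rV[R]_n.
Local Notation mu := (lebesgue_rV R n).
Variable (Om : set E).
Hypothesis mOm : measurable Om.
Implicit Types (f g h : E -> R).

Lemma norm1_ge0 f : (0 <= norm1 Om f)%E.
Proof. by apply: integral_ge0 => x _; rewrite lee_fin. Qed.

Lemma norm1_triangle g f h : measurable_fun Om f -> measurable_fun Om g ->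
  measurable_fun Om h ->
  (norm1 Om (f \- h)%R <= norm1 Om (f \- g)%R + norm1 Om (g \- h)%R)%E.
Proof.
move=> mf mg mh; rewrite /norm1.
have mB (a b : E -> R) : measurable_fun Om a -> measurable_fun Om b ->
    measurable_fun Om (fun x => `|(a \- b) x|%:E).
  move=> ma mb; apply/measurable_EFinP; apply: measurableT_comp => //.
  exact: measurable_funB.
have mfg := mB _ _ mf mg; have mgh := mB _ _ mg mh; have mfh := mB _ _ mf mh.
rewrite -ge0_integralD//.
apply: ge0_le_integral => //; first exact: emeasurable_funD.
move=> x _; rewrite -EFinD lee_fin /= (_ : f x - h x = f x - g x + (g x - h x)).
  exact: ler_normD.
by rewrite addrA subrK.
Qed.

Lemma norm1Z (c : R) f : measurable_fun Om f ->
  (norm1 Om (fun x => c * f x)%R = `|c|%:E * norm1 Om f)%E.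
Proof.
move=> mf; rewrite /norm1 -ge0_integralZl//.
- by apply: eq_integral => x _; rewrite normrM EFinM.
- by apply/measurable_EFinP; exact: measurableT_comp.
Qed.

Lemma L1P f : L1 Om f <-> measurable_fun Om f /\ (norm1 Om f < +oo)%E.
Proof.
rewrite /L1 /norm1; split=> [/integrableP[/measurable_EFinP mf fi]|[mf fi]].
  by split.
by apply/integrableP; split; first exact/measurable_EFinP.
Qed.

End norm1_theory.

Section density.
Variables (R : realType) (n : nat).
Local Notation E := 'rV[R]_n.
Local Notation mu := (lebesgue_rV R n).
Variable (Om : set E).
Hypotheses (oOm : open Om) (bOm : bounded_set Om).
Implicit Types (f g h : E -> R).

Let mOm : measurable Om := open_measurable_rV oOm.
Let fOm : (mu Om < +oo)%E := lebesgue_rV_bounded mOm bOm.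

(** The L^1 closure of C_c^1(Om). Measurability is included because the triangle inequality
    [norm1_triangle] asks for it. *)
Definition C1c_approx f := measurable_fun Om f /\
  forall e : R, 0 < e -> exists2 g, C1c Om g & (norm1 Om (f \- g)%R <= e%:E)%E.

Lemma C1c_measurable_on g (D : set E) : C1c Om g -> measurable_fun D g.
Proof. by move=> /C1c_measurable; exact: measurable_funTS. Qed.

Lemma C1c_approx_norm1 f : measurable_fun Om f ->
  (forall e : R, 0 < e -> exists2 g, C1c_approx g & (norm1 Om (f \- g)%R <= e%:E)%E) ->
  C1c_approx f.
Proof.
move=> mf H; split=> // e e0.
have e20 : 0 < e / 2 by rewrite divr_gt0.
have [g [mg ag] fg] := H _ e20; have [h Ch gh] := ag _ e20.
exists h => //; apply: le_trans (norm1_triangle mOm mf mg _) _.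
  exact: C1c_measurable_on Ch.
by rewrite [e in leRHS]splitr EFinD leeD.
Qed.

(** Dominated convergence with a constant bound, which is integrable because [Om] has finite
    measure. *)
Lemma C1c_approx_bounded_lim (F : (E -> R)^nat) f (C : R) :
  (forall k, C1c_approx (F k)) -> measurable_fun Om f ->
  (forall k x, Om x -> `|F k x| <= C) ->
  (forall x, Om x -> F ^~ x @ \oo --> f x) -> C1c_approx f.
Proof.
move=> aF mf FC Ff; apply: C1c_approx_norm1 => // e e0.
have [|||||_ cv _] := @dominated_convergence _ _ _ mu Om mOm
  (fun k => EFin \o F k) (EFin \o f) (EFin \o cst C).
- by move=> k; apply/measurable_EFinP; case: (aF k).
- exact/measurable_EFinP.
- by apply: aeW => x Ox; apply: cvg_EFin; [exact: nearW|exact: Ff].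
- by apply: measurable_bounded_integrable => //; exact: bounded_cst.
- by apply: aeW => x k Ox; rewrite lee_fin FC.
move/fine_cvgP : cv => [fin /cvgrPdist_le /(_ e e0)] cv.
near \oo => k; exists (F k) => //.
have Nfin : norm1 Om (f \- F k)%R = (\int[mu]_(x in Om) `|(EFin \o F k) x - (EFin \o f) x|)%E.
  by apply: eq_integral => x _; rewrite /= distrC.
rewrite Nfin -[leLHS]fineK; last by near: k.
rewrite lee_fin; apply: le_trans (ler_norm _) _.
by rewrite -normrN -[X in `|X|]sub0r; near: k.
Unshelve. all: by end_near. Qed.

Lemma C1c_approx_C1c g : C1c Om g -> C1c_approx g.
Proof.
move=> Cg; split; first exact: C1c_measurable_on Cg.
move=> e e0; exists g => //; rewrite /norm1 (eq_integral (cst 0%E)).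
  by rewrite integral0 lee_fin ltW.
by move=> x _ /=; rewrite subrr normr0.
Qed.

Lemma C1c_approxD f g : C1c_approx f -> C1c_approx g -> C1c_approx (f \+ g).
Proof.
move=> [mf af] [mg ag]; split; first exact: measurable_funD.
move=> e e0; have e20 : 0 < e / 2 by rewrite divr_gt0.
have [f' Cf' ff'] := af _ e20; have [g' Cg' gg'] := ag _ e20.
exists (f' \+ g'); first exact: C1cD.
have mf' := @C1c_measurable_on _ Om Cf'; have mg' := @C1c_measurable_on _ Om Cg'.
apply: le_trans (norm1_triangle mOm (g := f' \+ g) _ _ _) _; try exact: measurable_funD.
rewrite [e in leRHS]splitr EFinD leeD//.
  apply: le_trans ff'; rewrite /norm1 le_eqVlt; apply/orP; left; apply/eqP.
  by apply: eq_integral => x _; congr (`|_|%:E); rewrite /=; lra.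
apply: le_trans gg'; rewrite /norm1 le_eqVlt; apply/orP; left; apply/eqP.
by apply: eq_integral => x _; congr (`|_|%:E); rewrite /=; lra.
Qed.

Lemma C1c_approxZ (c : R) f : C1c_approx f -> C1c_approx (fun x => c * f x).
Proof.
move=> [mf af]; split; first exact: measurable_funM.
(* Dividing by [|c| + 1] instead of [|c|] also covers [c = 0]. *)
move=> e e0; have c0 : 0 < `|c| + 1 by rewrite ltr_wpDl.
have [g Cg fg] := af (e / (`|c| + 1)) (divr_gt0 e0 c0).
exists (cst c \* g); first by apply: C1c_mulr => //; exact: C1_cst.
rewrite (_ : norm1 _ _ = norm1 Om (fun x => c * (f \- g)%R x)); last first.
  by apply: eq_integral => x _; congr (`|_|%:E); rewrite /= mulrBr.
rewrite norm1Z//; last by apply: measurable_funB => //; exact: C1c_measurable_on Cg.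
apply: (@le_trans _ _ (`|c|%:E * (e / (`|c| + 1))%:E)%E).
  by rewrite lee_pmul// ?lee_fin// norm1_ge0.
rewrite -EFinM lee_fin mulrCA -[leRHS]mulr1 ler_pM2l// ler_pdivrMr// mul1r.
by rewrite lerDl.
Qed.

Lemma C1c_approx_sum (I : Type) (s : seq I) (F : I -> E -> R) :
  (forall i, C1c_approx (F i)) -> C1c_approx (fun x => \sum_(i <- s) F i x).
Proof.
move=> CF; elim: s => [|a s IHs].
  rewrite (_ : (fun _ => _) = cst 0); last by apply/funext => x; rewrite big_nil.
  exact/C1c_approx_C1c/C1c_cst0.
rewrite (_ : (fun _ => _) = F a \+ (fun x => \sum_(i <- s) F i x)).
  exact: C1c_approxD.
by apply/funext => x; rewrite big_cons.
Qed.

Lemma eq_C1c_approx f g : {in Om, f =1 g} -> C1c_approx f -> C1c_approx g.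
Proof.
move=> fg [mf af]; split; first exact: eq_measurable_fun mf.
move=> e e0; have [h Ch fh] := af e e0; exists h => //.
apply: le_trans fh; rewrite le_eqVlt; apply/orP; left; apply/eqP.
by apply: eq_integral => x xO; rewrite /= fg.
Qed.

End density.

Section indicator_density.
Variables (R : realType) (n : nat).
Local Notation E := 'rV[R]_n.
Local Notation mu := (lebesgue_rV R n).
Variable (Om : set E).
Hypotheses (oOm : open Om) (bOm : bounded_set Om).
Implicit Types (f g h : E -> R).

Let mOm : measurable Om := open_measurable_rV oOm.

(* The indices range over the rational balls; a ball whose double is not
   included in [U] contributes the zero function. *)
Definition open_bump (U : set E) (j : nat) (x : E) : R :=
  if unpickle j is Some p then
    if `[< @rat_ball R n 2 p `<=` U >] then ball_bump (map_mx ratr p.1) (p.2.+1%:R^-1) x else 0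
  else 0.

Lemma open_bump_ge0 U j x : 0 <= open_bump U j x.
Proof.
by rewrite /open_bump; case: unpickle => // p; case: ifP => // _; exact: ball_bump_ge0.
Qed.

Lemma C1c_open_bump U j : C1c U (open_bump U j).
Proof.
rewrite /open_bump; case: unpickle => [p|]; last exact: C1c_cst0.
case: (boolP `[< _ >]) => [/asboolP pU|_]; last exact: C1c_cst0.
apply: (@C1c_ball_bump _ _ _ _ _ (2 * p.2.+1%:R^-1)) => //.
by rewrite invr_gt0 ltr0n/= mulr_natl mulr2n ltrDl invr_gt0 ltr0n.
Qed.

Lemma open_bump_gt0 U x : open U -> U x -> exists j, 0 < open_bump U j x.
Proof.
move=> oU Ux; have [p [xp pU]] := rat_ball_nbhs oU Ux (ltr0n R 2).
exists (pickle p); rewrite /open_bump pickleK.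
case: ifPn => [_|/asboolP//]; rewrite lt_neqAle ball_bump_ge0 andbT eq_sym.
apply/ball_bump_neq0; first by rewrite invr_gt0.
by move: xp; rewrite /rat_ball mul1r.
Qed.

(** Partial sums of the bumps vanish off [U] and, at a point of [U], stay above a positive value
    from some index on. The factor [k] inside the sigmoid then drives the value to 1, while off [U]
    it remains 0. *)
Lemma open_indic_approx (U : set E) : open U -> U `<=` Om ->
  C1c_approx Om (\1_U : E -> R).
Proof.
move=> oU UOm.
pose S k x := \sum_(j <- iota 0 k) open_bump U j x.
have S0 k x : 0 <= S k x by rewrite /S sumr_ge0// => j _; exact: open_bump_ge0.
have CS k : C1c U (S k) by apply: C1c_sum => j; exact: C1c_open_bump.
pose F k : E -> R := sigmoid k%:R \o S k.
have CF k : C1c U (F k).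
  exact: (C1c_comp (@derivable_sigmoid R k%:R) (@continuous_derive_sigmoid R k%:R)
    (sigmoid0 k%:R) (CS k)).
apply: (@C1c_approx_bounded_lim _ _ Om oOm bOm F _ 1).
- by move=> k; apply: C1c_approx_C1c; exact: C1c_sub (CF k).
- by apply: measurable_indic; exact: open_measurable_rV.
- by move=> k x _; exact: sigmoid_norm_le1.
move=> x Ox; rewrite indicE; case: (boolP (x \in U)) => [|/negP]; rewrite inE => Ux; last first.
  rewrite (_ : (fun k => F k x) = cst 0); first exact: cvg_cst.
  apply/funext => k; apply: notin_supp => /(_ _) xs.
  by case: (CF k) => _ _ /(_ x xs).
have [j j0] := open_bump_gt0 oU Ux.
(* For [k > j] the sum dominates this fixed bump, so [sigmoid_ge] gives the lower bound
   [1 - 2 / (k * s)]. *)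
pose s := open_bump U j x.
have Ss k : (j < k)%N -> s <= S k x.
  move=> jk; rewrite /S (bigD1_seq j) ?iota_uniq ?mem_iota//= lerDl sumr_ge0//.
  by move=> i _; exact: open_bump_ge0.
apply: (@squeeze_cvgr _ _ _ _ (fun k => 1 - 2 / (k%:R * s)) (cst 1)).
- near=> k; have k0 : (0 : R) < k%:R by rewrite ltr0n; near: k; exact: nbhs_infty_gt.
  have sk : s <= S k x by apply: Ss; near: k; exact: nbhs_infty_gt.
  have Sk0 : 0 < S k x by exact: lt_le_trans sk.
  apply/andP; split.
    apply: le_trans (sigmoid_ge k0 Sk0); rewrite lerD2l lerN2 ler_pM2l//.
    by rewrite lef_pV2 ?posrE ?mulr_gt0// ler_pM2l.
  by rewrite (le_trans (ler_norm _))// sigmoid_norm_le1.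
- rewrite -[X in _ --> X]subr0; apply: cvgB; first exact: cvg_cst.
  rewrite (_ : (fun k : nat => _) = fun k : nat => (2 / s) * k%:R^-1); last first.
    by apply/funext => k; rewrite invfM mulrCA mulrC.
  rewrite -[X in _ --> X](mulr0 (2 / s)); apply: cvgMr.
  apply/gtr0_cvgV0; last exact: cvgr_idn.
  by near=> k; rewrite ltr0n; near: k; exact: nbhs_infty_gt.
- exact: cvg_cst.
Unshelve. all: by end_near. Qed.

(** Open sets are stable under intersection and generate the measurable sets; by Dynkin's argument
    it remains to treat complements and disjoint unions. An open set may leave [Om], but only its
    trace on [Om] matters. *)
Lemma indic_approx (A : set E) : measurable A -> C1c_approx Om (\1_A : E -> R).
Proof.
have setIP (B : set E) : {in Om, \1_(B `&` Om) =1 (\1_B : E -> R)}.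
  by move=> x xO; rewrite !indicE in_setI xO andbT.
have aT : C1c_approx Om (\1_[set: E] : E -> R).
  by apply: eq_C1c_approx (setIP setT) _; rewrite setTI; exact: open_indic_approx.
apply: (@dynkin_induction _ E (@open E) (fun A => C1c_approx Om (\1_A : E -> R))) => //.
- by move=> B C; exact: openI.
- move=> B oB; apply: eq_C1c_approx (setIP B) _.
  by apply: open_indic_approx; [exact: openI|exact: subIsetr].
- move=> S mS aS.
  rewrite (_ : \1_(~` S) = (\1_[set: E] : E -> R) \+ (fun x => -1 * \1_S x)).
    by apply: C1c_approxD => //; exact: C1c_approxZ.
  apply/funext => x; rewrite indicC indicT /= indicE mulN1r.
  by case: (x \in S); rewrite /= ?subrr ?subr0.
- move=> F mF tF aF.
  pose G k x := \sum_(i <- iota 0 k) (\1_(F i) x : R).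
  (* Disjointness makes the partial sum an indicator, hence bounded by 1, as dominated convergence
     requires. *)
  have GE k x : G k x = \1_(\bigcup_(i < k) F i) x.
    rewrite /G indicE; case: (boolP (x \in _)) => [|/negP]; rewrite inE.
      move=> [i /= ik Fix]; rewrite (bigD1_seq i) ?iota_uniq ?mem_iota//=.
      rewrite indicE mem_set// big1_seq ?addr0// => j /andP[ji _].
      rewrite indicE memNset// => Fjx.
      by move/trivIsetP : tF => /(_ j i I I ji); apply/eqP/set0P; exists x.
    move=> nF; apply: big1_seq => j /andP[_]; rewrite mem_iota add0n => /= jk.
    by rewrite indicE memNset// => Fjx; apply: nF; exists j.
  apply: (@C1c_approx_bounded_lim _ _ Om oOm bOm G _ 1).
  + by move=> k; exact: C1c_approx_sum.
  + by apply: measurable_indic; exact: bigcup_measurable.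
  + by move=> k x _; rewrite GE indicE; case: (_ \in _); rewrite ?normr1 ?normr0.
  + move=> x _; rewrite indicE; case: (boolP (x \in _)) => [|/negP]; rewrite inE.
      move=> [i _ Fix]; apply: cvg_near_cst; near=> k; rewrite GE indicE mem_set//.
      by exists i => //=; near: k; exact: nbhs_infty_gt.
    move=> nF; apply: cvg_near_cst; near=> k; rewrite GE indicE memNset//.
    by move=> [i _ Fix]; apply: nF; exists i.
Unshelve. all: by end_near. Qed.

End indicator_density.

Import HBSimple.

(** * Integrable functions and their products with bounded functions *)

Section L1_theory.
Variables (R : realType) (n : nat).
Local Notation E := 'rV[R]_n.
Local Notation mu := (lebesgue_rV R n).
Variable (D : set E).
Hypothesis mD : measurable D.
Implicit Types (f g w : E -> R).

Lemma L1_measurable f : L1 D f -> measurable_fun D f.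
Proof. by move/L1P => []. Qed.

Lemma L1D f g : L1 D f -> L1 D g -> L1 D (f \+ g).
Proof. by move=> fi gi; exact: (integrableD mD fi gi). Qed.

Lemma L1B f g : L1 D f -> L1 D g -> L1 D (f \- g).
Proof. by move=> fi gi; exact: (integrableB mD fi gi). Qed.

Lemma L1_fin_num f : L1 D f -> norm1 D f \is a fin_num.
Proof.
by move/L1P => [_ ?]; rewrite ge0_fin_numE// norm1_ge0.
Qed.

Lemma L1_mul f g (M : R) : L1 D f -> measurable_fun setT g ->
  (forall x, `|g x| <= M) -> L1 D (f \* g).
Proof.
move=> fi mg gM; rewrite /L1 (_ : EFin \o _ = (EFin \o f) \* (EFin \o g))%E//.
apply: integrableMl => //; first exact: measurable_funTS.
exists M; split; first by rewrite num_real.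
by move=> N MN x _ /=; exact: le_trans (gM x) (ltW MN).
Qed.

Lemma L1_norm f : L1 D f -> L1 D (fun x => `|f x|).
Proof. exact: integrable_norm. Qed.

Lemma norm1E f : L1 D f -> norm1 D f = (\int[mu]_(x in D) `|f x|)%:E.
Proof. by move=> fi; rewrite /Rintegral fineK// L1_fin_num. Qed.

Lemma Rintegral_mul_le f g (M : R) : L1 D f -> measurable_fun setT g ->
  (forall x, `|g x| <= M) ->
  `|\int[mu]_(x in D) (f x * g x)| <= M * \int[mu]_(x in D) `|f x|.
Proof.
move=> fi mg gM; apply: le_trans (le_normr_Rintegral mD _) _.
  exact: (L1_mul fi mg gM).
rewrite -RintegralZl//; last exact: L1_norm.
apply: le_Rintegral => //.
- exact/L1_norm/(L1_mul fi mg gM).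
- have := integrableZl mD M (L1_norm fi); exact.
- by move=> x _; rewrite normrM mulrC ler_wpM2r.
Qed.

Lemma C1c_L1 U g : (mu D < +oo)%E -> C1c U g -> L1 D g.
Proof.
move=> fD Cg; have [M M0 gM] := C1c_bounded Cg.
apply: measurable_bounded_integrable => //.
  exact: measurable_funTS (C1c_measurable Cg).
exists M; split; first by rewrite num_real.
by move=> N MN x _ /=; exact: le_trans (gM x) (ltW MN).
Qed.

End L1_theory.

Section L1_density.
Variables (R : realType) (n : nat).
Local Notation E := 'rV[R]_n.
Local Notation mu := (lebesgue_rV R n).
Variable (Om : set E).
Hypotheses (oOm : open Om) (bOm : bounded_set Om).
Implicit Types (f g w : E -> R).

Let mOm : measurable Om := open_measurable_rV oOm.
Let fOm : (mu Om < +oo)%E := lebesgue_rV_bounded mOm bOm.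

(** Simple functions are dense in L^1, and each is a linear combination of indicators. *)
Lemma L1_C1c_approx f : L1 Om f -> C1c_approx Om f.
Proof.
move=> fi; apply: C1c_approx_norm1 => //; first exact: L1_measurable fi.
move=> e e0; have [g [_ _ gf]] := approximation_sfun_integrable mOm fi.
move/fine_cvgP : gf => [fin /cvgrPdist_le /(_ e e0) cv].
near \oo => k; exists (g k).
  apply: eq_C1c_approx => [x _|]; first exact/esym/fimfunEord.
  apply: C1c_approx_sum => // i; apply: C1c_approxZ => //.
  by apply: indic_approx => //; exact: measurable_sfunP.
rewrite /norm1 -[leLHS]fineK; last by near: k.
rewrite lee_fin; apply: le_trans (ler_norm _) _.
by rewrite -normrN -[X in `|X|]sub0r; near: k.
Unshelve. all: by end_near. Qed.

Lemma C1c_sigmoid (k : R) g : C1c Om g -> C1c Om (sigmoid k \o g).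
Proof.
exact: (C1c_comp (@derivable_sigmoid R k) (@continuous_derive_sigmoid R k)
    (sigmoid0 k)).
Qed.

(* [sigmoid k \o g0], for a test function [g0] close to [w] and [k] large, is
   an admissible approximation of the sign of [w]. *)
Lemma norm1_dual_le w (C : R) : L1 Om w ->
  (forall g, C1c Om g -> (forall x, `|g x| <= 1) ->
    \int[mu]_(x in Om) (w x * g x) <= C) ->
  (norm1 Om w <= C%:E)%E.
Proof.
move=> wi H; rewrite norm1E// lee_fin; apply/ler_addgt0Pr => e e0.
have e40 : 0 < e / 4 by rewrite divr_gt0.
have [_ /(_ _ e40)[g0 Cg0 wg0]] := L1_C1c_approx wi.
have g0i := C1c_L1 mOm fOm Cg0.
have wg0i := L1B mOm wi g0i.
rewrite norm1E// lee_fin in wg0.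
pose m := fine (mu Om).
have m0 : 0 <= m by rewrite fine_ge0.
(* This [k] makes the total loss [(2 / k) * m] of the sigmoid at most [e / 4]; adding 1 to [m]
   avoids a division by 0. Two more quarters of [e] come from exchanging [w] and [g0], once in the
   norm and once in the pairing. *)
pose k := 2 * (m + 1) / (e / 4).
have k0 : 0 < k by rewrite divr_gt0// mulr_gt0// ltr_wpDl.
pose g := sigmoid k \o g0.
have Cg : C1c Om g by exact: C1c_sigmoid.
have g1 x : `|g x| <= 1 by exact: sigmoid_norm_le1.
have mg := C1c_measurable Cg.
have wgC := H g Cg g1.
have wgi := L1_mul mOm wi mg g1.
have g0gi := L1_mul mOm g0i mg g1.
have dgi := L1_mul mOm wg0i mg g1.
have ci : L1 Om (cst (2 / k)).
  by apply: measurable_bounded_integrable => //; exact: bounded_cst.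
have h1 : \int[mu]_(x in Om) `|w x| <=
    \int[mu]_(x in Om) `|w x - g0 x| + \int[mu]_(x in Om) `|g0 x|.
  rewrite -RintegralD//; [|exact: L1_norm|exact: L1_norm].
  apply: le_Rintegral => //; [exact: L1_norm| |].
    exact: (L1D mOm (L1_norm wg0i) (L1_norm g0i)).
  by move=> x _; rewrite -[in leLHS](subrK (g0 x) (w x)) ler_normD.
have h2 : \int[mu]_(x in Om) `|g0 x| <=
    \int[mu]_(x in Om) (g0 x * g x) + \int[mu]_(x in Om) (cst (2 / k) x).
  rewrite -RintegralD//.
  apply: le_Rintegral => //; [exact: L1_norm|exact: (L1D mOm g0gi ci)|].
  by move=> x _; rewrite -lerBlDr mul_sigmoid_ge.
have h3 : \int[mu]_(x in Om) (cst (2 / k) x) <= e / 4.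
  rewrite Rintegral_cst// -/m /k.
  rewrite (_ : _ * m = (e / 4) * (m / (m + 1))); last first.
    by field; rewrite !gt_eqF//= ltr_wpDl.
  by rewrite ger_pMr// ler_pdivrMr ?ltr_wpDl// mul1r lerDl.
have h4 : \int[mu]_(x in Om) (g0 x * g x) = \int[mu]_(x in Om) (w x * g x) -
    \int[mu]_(x in Om) ((w x - g0 x) * g x).
  rewrite -RintegralB//; apply: eq_Rintegral => x _; ring.
have h5 : `|\int[mu]_(x in Om) ((w x - g0 x) * g x)| <= 1 * \int[mu]_(x in Om) `|w x - g0 x|.
  exact: (Rintegral_mul_le mOm wg0i mg g1).
move: h5; rewrite ler_norml => /andP[h5 _].
lra.
Qed.

End L1_density.

(** * Differentiating along translations *)

Section derivative_of_translates.
Variables (R : realType) (n : nat).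
Local Notation E := 'rV[R]_n.
Local Notation mu := (lebesgue_rV R n).
Implicit Types (f g w : E -> R) (D U Om : set E).

Lemma is_derive_along g (y z : E) (a : R) : differentiable g (y + a *: z) ->
  is_derive a 1 (fun t : R => g (y + t *: z)) ('D_z g (y + a *: z)).
Proof.
move=> /(@diff_derivable _ _ _ _ _ z) dg.
have E1 : (fun h : R => h^-1 *: (((fun t : R => g (y + t *: z)) \o shift a) (h *: (1 : R)) - g (y + a *: z))) =
    (fun h : R => h^-1 *: ((g \o shift (y + a *: z)) (h *: z) - g (y + a *: z))).
  apply/funext => h /=; congr (_ *: (g _ - _)).
  by rewrite [h *: (1 : R)]mulr1 scalerDl addrCA.
by split; rewrite /derivable /derive E1.
Qed.

Lemma Rintegral_supp D f : (forall x, ~ D x -> f x = 0) ->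
  \int[mu]_(x in D) f x = \int[mu]_x f x.
Proof.
move=> f0; rewrite Rintegral_mkcond; congr (Rintegral mu setT _).
by apply/funext => x; rewrite patchE; case: ifPn => // /negP; rewrite inE => /f0.
Qed.

(** All regularity is asked of [g]: the derivative of the integrand is bounded by [Q * |w y|]
    uniformly in the shift, and this integrable function permits differentiation under the integral
    sign. *)
Lemma is_derive_integral_along D U w g z (a : R) : measurable D -> L1 D w ->
  C1c U g ->
  is_derive a 1 (fun t : R => \int[mu]_(y in D) (w y * g (y + t *: z)))
    (\int[mu]_(y in D) (w y * \sum_i z 0 i * partial i g (y + a *: z))).
Proof.
move=> mD wi Cg; have [[dg cg] _ _] := Cg.
have [M M0 gM] := C1c_bounded Cg.
have /choice[P PM] i : exists P : R, 0 <= P /\ forall x, `|partial i g x| <= P.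
  by have [P P0 HP] := C1c_partial_bounded i Cg; exists P.
pose Q := \sum_i `|z 0 i| * P i.
have Q0 : 0 <= Q by apply: sumr_ge0 => i _; rewrite mulr_ge0//; case: (PM i).
have ia (t : R) (y : E) : is_derive t 1 (fun t : R => w y * g (y + t *: z)) (w y * \sum_i z 0 i * partial i g (y + t *: z)).
  rewrite -derive_partial//.
  have h := is_derive_along (dg (y + t *: z)).
  exact: (is_deriveZ (w y) h).
have Qb (t : R) (y : E) : `|\sum_i z 0 i * partial i g (y + t *: z)| <= Q.
  apply: le_trans (ler_norm_sum _ _ _) _; apply: ler_sum => i _.
  by rewrite normrM ler_wpM2l//; case: (PM i).
pose f (t : R) (y : E) : R := w y * g (y + t *: z).
have d1E t y : partial1of2 f t y = w y * \sum_i z 0 i * partial i g (y + t *: z).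
  by rewrite partial1of2E; have [] := ia t y.
have aI : a \in `]a - 1, a + 1[ by rewrite in_itv/= ltrBlDr ltrDl ltr01.
have fi (t : R) : `]a - 1, a + 1[%classic t -> mu.-integrable D (EFin \o f t).
  move=> _; apply: (@L1_mul _ _ _ mD w (fun y => g (y + t *: z)) M) => //.
  exact: (measurableT_comp (C1c_measurable Cg) (measurable_shift_rV _)).
have dfi (t : R) (y : E) : `]a - 1, a + 1[%classic t -> D y -> derivable (f ^~ y) t 1.
  by move=> _ _; have [] := ia t y.
have Gi : mu.-integrable D (EFin \o (fun y => Q * `|w y|)).
  exact: (integrableZl mD Q (L1_norm wi)).
have Gub (t : R) (y : E) : `]a - 1, a + 1[%classic t -> D y -> `|partial1of2 f t y| <= Q * `|w y|.
  by move=> _ _; rewrite d1E normrM mulrC ler_wpM2r.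
have G0 y : 0 <= Q * `|w y| by rewrite mulr_ge0.
have h1 := derivable_under_integral mD aI fi dfi G0 Gi Gub.
have h2 := differentiation_under_integral mD aI fi dfi G0 Gi Gub.
split; first exact: h1.
rewrite -derive1E h2; apply: eq_Rintegral => y _; exact: d1E.
Qed.

Lemma C1c_supp_ball U f : C1c U f -> exists2 M, 0 < M & forall x, supp f x -> ball (0 : E) M x.
Proof.
move=> [_ /compact_bounded[M [_ HM]] _].
exists (`|M| + 2); first by rewrite ltr_wpDl.
move=> x sx; rewrite -ball_normE /= sub0r normrN.
have := HM (`|M| + 1) _ _ sx; rewrite (le_lt_trans (ler_norm _)) ?ltrDl//.
move=> /(_ isT) h; apply: le_lt_trans h _; lra.
Qed.

(* By translation invariance the integral of [fun x => f (x + t *: 'e_i)] does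
   not depend on [t]; its derivative at [t = 0] is the integral to compute. *)
Lemma Rintegral_partial_eq0 U f i : C1c U f -> \int[mu]_x partial i f x = 0.
Proof.
move=> Cf; have [M M0 fM] := C1c_supp_ball Cf.
pose e : E := 'e_i.
(* This ball contains the supports of all translates of [f] by [t *: e] with [|t| < 1]. It has
   finite measure, so the constant 1 is an admissible weight on it. *)
pose D : set E := ball (0 : E) (M + `|e|).
have mD : measurable D by exact: measurable_ball_rV.
have fD : (mu D < +oo)%E by apply: lebesgue_rV_bounded => //; exact: bounded_ball_rV.
have ci : L1 D (cst 1) by apply: measurable_bounded_integrable => //; exact: bounded_cst.
have := is_derive_integral_along (e : E) 0 mD ci Cf.
set F := (X in is_derive _ _ X _).
have Fc t : `|t| < 1 -> F t = \int[mu]_x f x.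
  move=> t1; rewrite /F Rintegral_supp.
    under eq_Rintegral do rewrite mul1r.
    exact: (Rintegral_shift _ (C1c_measurable Cf)).
  move=> x; rewrite mul1r => nx; apply: notin_supp => /fM xM; apply: nx.
  move: xM; rewrite /D -!ball_normE /= !sub0r !normrN => xM.
  rewrite -(addrK (t *: e) x) (le_lt_trans (ler_normB _ _))// ltr_leD//.
  by rewrite normrZ ler_piMl// ltW.
move=> [_]; rewrite (@near_eq_derive _ _ _ F (cst (\int[mu]_x f x))); last first.
  near=> t; apply: Fc; near: t.
  exact: (@nbhs0_lt R R^o 1 ltr01).
rewrite derive_cst => /esym; under eq_Rintegral => x _.
  rewrite mul1r (bigD1 i)//= big1 => [|j ji]; last by rewrite /e mxE eqxx/= (negbTE ji) mul0r.
  rewrite /e mxE !eqxx mul1r addr0 scale0r addr0.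
  over.
rewrite Rintegral_supp// => x nx; apply: partial_notin_supp => /fM sx.
by apply: nx; apply: le_ball sx; rewrite lerDl.
Unshelve. all: by end_near. Qed.

End derivative_of_translates.

Section euclidean_norm.
Variables (R : realType) (I : finType).
Implicit Types (a : I -> R).

Lemma le_enorm a i : `|a i| <= enorm a.
Proof.
rewrite /enorm -sqrtr_sqr ler_wsqrtr// (bigD1 i)//= lerDl sumr_ge0// => j _.
exact: sqr_ge0.
Qed.

Lemma enormZ (c : R) a : enorm (fun i => c * a i) = `|c| * enorm a.
Proof.
rewrite /enorm (_ : \sum_i _ = c ^+ 2 * \sum_i a i ^+ 2).
  by rewrite sqrtrM ?sqr_ge0// sqrtr_sqr.
by rewrite mulr_sumr; apply: eq_bigr => i _; rewrite exprMn.
Qed.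

Lemma enorm_le_sum a : enorm a <= \sum_i `|a i|.
Proof.
have s0 : 0 <= \sum_i `|a i| by exact: sumr_ge0.
rewrite /enorm -[leRHS]ger0_norm// -sqrtr_sqr ler_wsqrtr//.
rewrite expr2 big_distrl/=; apply: ler_sum => i _.
rewrite -real_normK ?num_real// expr2 ler_wpM2l//.
by rewrite (bigD1 i)//= lerDl sumr_ge0.
Qed.

End euclidean_norm.

(** * Elementary properties of the variation *)

Section variation.
Variables (R : realType) (n : nat).
Local Notation E := 'rV[R]_n.
Local Notation mu := (lebesgue_rV R n).
Implicit Types (f g w : E -> R) (phi : 'I_n -> E -> R) (D U Om : set E).

Lemma C1cZ Om (c : R) f : C1c Om f -> C1c Om (fun x => c * f x).
Proof. by move=> Cf; apply: (C1c_mulr (C1_cst n c) Cf). Qed.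

Lemma partialZ (c : R) f i : C1 f ->
  partial i (fun x => c * f x) = fun x => c * partial i f x.
Proof.
move=> Cf; have := partialM i (C1_cst n c) Cf.
rewrite (_ : partial i (cst c) = cst 0); last first.
  by apply/funext => x; rewrite /partial derive_cst.
by move=> h; apply: etrans h _; apply/funext => x /=; rewrite mulr0 addr0.
Qed.

Lemma divZ (c : R) phi : (forall i, C1 (phi i)) ->
  div (fun i x => c * phi i x) = fun x => c * div phi x.
Proof.
move=> Cphi; apply/funext => x; rewrite /div mulr_sumr.
by apply: eq_bigr => i _; rewrite partialZ.
Qed.

Lemma div_measurable Om phi : (forall i, C1c Om (phi i)) ->
  measurable_fun setT (div phi).
Proof.
move=> Cphi; apply: continuous_measurable_rV; rewrite /div.
elim: (index_enum _) => [|i s IHs].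
  rewrite (_ : (fun _ => _) = cst 0); first exact: cst_continuous.
  by apply/funext => x; rewrite big_nil.
rewrite (_ : (fun _ => _) = partial i (phi i) \+ (fun x => \sum_(j <- s) partial j (phi j) x)).
  move=> x; have [[_ /(_ i x) ci] _ _] := Cphi i.
  exact: (cvgD ci (IHs x)).
by apply/funext => x; rewrite big_cons.
Qed.

Lemma div_bounded Om phi : (forall i, C1c Om (phi i)) ->
  exists2 M, 0 <= M & forall x, `|div phi x| <= M.
Proof.
move=> Cphi.
have /choice[P PM] i : exists P : R, 0 <= P /\ forall x, `|partial i (phi i) x| <= P.
  by have [P P0 HP] := C1c_partial_bounded i (Cphi i); exists P.
exists (\sum_i P i); first by apply: sumr_ge0 => i _; case: (PM i).
move=> x; apply: le_trans (ler_norm_sum _ _ _) _; apply: ler_sum => i _.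
by case: (PM i).
Qed.

Lemma L1_mul_div Om w phi : measurable Om -> L1 Om w -> (forall i, C1c Om (phi i)) ->
  L1 Om (fun x => w x * div phi x).
Proof.
move=> mOm wi Cphi; have [M M0 HM] := div_bounded Cphi.
exact: (L1_mul mOm wi (div_measurable Cphi) HM).
Qed.

(** The pairings are finite because [w] is integrable and the divergence bounded; this allows
    working with real inequalities instead of an extended supremum. *)
Lemma Var_leP Om w (M : R) : measurable Om -> L1 Om w ->
  (Var Om w <= M%:E)%E <->
  (forall phi, (forall i, C1c Om (phi i)) ->
    (forall x, Om x -> enorm (phi ^~ x) <= 1) ->
    \int[mu]_(x in Om) (w x * div phi x) <= M).
Proof.
move=> mOm wi; have fE phi : (forall i, C1c Om (phi i)) ->
    (\int[mu]_(x in Om) (w x * div phi x)%:E)%E =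
    (\int[mu]_(x in Om) (w x * div phi x))%:E.
  by move=> Cphi; rewrite /Rintegral fineK//; apply: integrable_fin_num => //; exact: L1_mul_div.
split=> [VM phi Cphi phi1|H].
  rewrite -lee_fin -fE//; apply: le_trans VM.
  by apply: ereal_sup_ubound; exists phi.
by apply: ub_ereal_sup => _ [phi [Cphi phi1] <-]; rewrite fE// lee_fin H.
Qed.

Lemma Var_ge0 Om w : (0 <= Var Om w)%E.
Proof.
apply: ereal_sup_ubound; exists (fun _ => cst 0).
  split=> [i|x _]; first exact: C1c_cst0.
  rewrite /enorm big1 ?sqrtr0// => i _.
  by rewrite expr0n.
rewrite (eq_integral (cst 0%E)) ?integral0// => x _.
rewrite /div big1 ?mulr0// => i _.
by rewrite /partial derive_cst.
Qed.

Lemma Var_pairing Om w phi (M K : R) : measurable Om -> L1 Om w ->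
  (Var Om w <= M%:E)%E -> 0 < K -> (forall i, C1c Om (phi i)) ->
  (forall x, Om x -> enorm (phi ^~ x) <= K) ->
  \int[mu]_(x in Om) (w x * div phi x) <= K * M.
Proof.
move=> mOm wi /(Var_leP _ mOm wi) VM K0 Cphi phiK.
have := VM (fun i x => K^-1 * phi i x); rewrite divZ; last by move=> i; case: (Cphi i).
rewrite (eq_Rintegral _ (g := fun x => K^-1 * (w x * div phi x))); last first.
  by move=> x _; rewrite mulrCA.
rewrite RintegralZl//; last exact: L1_mul_div.
rewrite ler_pdivrMl//; apply; first by move=> i; exact: C1cZ.
by move=> x Ox; rewrite enormZ gtr0_norm ?invr_gt0// ler_pdivrMl// mulr1 phiK.
Qed.

Lemma VarB_le Om v w (M1 M2 : R) : measurable Om -> L1 Om v -> L1 Om w ->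
  (Var Om v <= M1%:E)%E -> (Var Om w <= M2%:E)%E ->
  (Var Om (v \- w)%R <= (M1 + M2)%:E)%E.
Proof.
move=> mOm vi wi VM1 /(Var_leP _ mOm wi) VM2.
apply/(Var_leP _ mOm (L1B mOm vi wi)) => phi Cphi phi1.
rewrite (eq_Rintegral _ (g := fun x => v x * div phi x + w x * div (fun i x => -1 * phi i x) x)); last first.
  move=> x _; rewrite divZ; last by move=> i; case: (Cphi i).
  by rewrite /=; ring.
have Cphi' i : C1c Om (fun x => -1 * phi i x) by exact: C1cZ.
rewrite RintegralD//; [|exact: L1_mul_div|exact: L1_mul_div].
apply: lerD; first by move/(Var_leP _ mOm vi) : VM1; apply.
apply: VM2 => // x Ox; by rewrite enormZ normrN1 mul1r phi1.
Qed.

(** Ensures that a test function close to [u] is a competitor of finite variation. Integration by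
    parts moves the derivatives to [g], where they are bounded, and the components of an admissible
    field are at most 1 in absolute value. *)
Lemma Var_C1c_lty Om g : measurable Om -> (mu Om < +oo)%E -> C1c Om g ->
  (Var Om g < +oo)%E.
Proof.
move=> mOm fOm Cg.
have L1c h (Ch : C1c Om h) : L1 Om h := C1c_L1 mOm fOm Ch.
have gi := L1c _ Cg.
have /choice[P PM] i : exists P : R, 0 <= P /\ forall x, `|partial i g x| <= P.
  by have [P P0 HP] := C1c_partial_bounded i Cg; exists P.
apply: (@le_lt_trans _ _ (\sum_i (P i * fine (mu Om)))%:E); last exact: ltry.
apply/(Var_leP _ mOm gi) => phi Cphi phi1.
have gpi i : L1 Om (fun x => g x * partial i (phi i) x).
  have [Q _ HQ] := C1c_partial_bounded i (Cphi i).
  exact: (L1_mul mOm gi (C1c_partial_measurable i (Cphi i)) HQ).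
have pgi i : L1 Om (fun x => phi i x * partial i g x).
  have [_ HQ] := PM i.
  exact: (L1_mul mOm (L1c _ (Cphi i)) (C1c_partial_measurable i Cg) HQ).
(* The product [g \* phi i] is again a test function, so its partial derivative has integral 0 by
   [Rintegral_partial_eq0]. *)
have IBP i : \int[mu]_(x in Om) (g x * partial i (phi i) x) =
    - \int[mu]_(x in Om) (phi i x * partial i g x).
  have [C1g _ _] := Cg; have [C1p _ _] := Cphi i.
  have CM : C1c Om (g \* phi i) by exact: C1c_mulr.
  apply/eqP; rewrite -subr_eq0 opprK -RintegralD//; [|exact: gpi|exact: pgi].
  rewrite -(Rintegral_partial_eq0 i CM) -(Rintegral_supp (D := Om)); last first.
    move=> x nx; apply: partial_notin_supp => sx; apply: nx.
    by case: CM => _ _; apply.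
  by rewrite partialM.
rewrite (eq_Rintegral _ (g := fun x => \sum_i g x * partial i (phi i) x)); last first.
  by move=> x _; rewrite /div mulr_sumr.
have -> : \int[mu]_(x in Om) (\sum_i g x * partial i (phi i) x) =
    \sum_i \int[mu]_(x in Om) (g x * partial i (phi i) x).
  rewrite /Rintegral sum_fine//; last first.
    by move=> i _; apply: integrable_fin_num => //; exact: gpi.
  rewrite -integral_sum//.
  by congr fine; apply: eq_integral => x _; rewrite sumEFin.
apply: ler_sum => i _; rewrite IBP.
apply: le_trans (ler_norm _) _; rewrite normrN.
apply: le_trans (le_normr_Rintegral mOm (pgi i)) _.
rewrite -Rintegral_cst//; apply: le_Rintegral => //.
- exact: L1_norm.
- by apply: measurable_bounded_integrable => //; exact: bounded_cst.
move=> x Ox; rewrite normrM -[leRHS]mul1r ler_pM//.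
  exact: le_trans (le_enorm (phi ^~ x) i) (phi1 x Ox).
by case: (PM i).
Qed.

(* The integral of [w] against [fun x => g (x - t *: z)] has derivative in [t]
   the integral of [w] against the divergence of [- g (x - t *: z) *: z], which
   the variation controls when [|g| <= 1]. *)
Lemma translation_le Om w (M r h : R) (c z : E) : open Om -> L1 Om w ->
  (Var Om w <= M%:E)%E -> 0 < r -> ball c (r + r) `<=` Om -> 
  h <= r -> `|z| < h ->
  (norm1 (ball c r) (fun x => (w \_ Om) (x + z) - (w \_ Om) x)%R <=
   (n.+1%:R * h * M)%:E)%E.
Proof.
move=> oOm wi VM r0 cOm hr zh.
have mOm := open_measurable_rV oOm.
have h0 : 0 < h by apply: le_lt_trans zh.
(* Extension by 0 allows integrals to be translated over the whole space. The ball sees none of the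
   added values, since [|z| < r] and the double ball lies in [Om]. *)
pose wt := w \_ Om.
have wti : L1 setT wt.
  have := wi; rewrite /L1 integrable_mkcond// => /eq_integrable; apply => // x _.
  by rewrite /= /wt !patchE; case: ifP.
have wtzi : L1 setT (fun x => wt (x + z)).
  apply/L1P; split; first exact: (measurableT_comp (L1_measurable wti) (measurable_shift_rV z)).
  have [mwt] := (L1P _ _).1 wti; rewrite /norm1.
  rewrite -(ge0_integral_shift z (f := fun x => `|wt x|%:E))//.
  by apply/measurable_EFinP; exact: measurableT_comp.
have mB := @measurable_ball_rV R n c r.
have BT f : L1 setT f -> L1 (ball c r) f.
  by move=> fi; apply: (@integrableS _ _ _ mu setT) => //.
apply: (@norm1_dual_le _ _ _ (ball_open _ _) (@bounded_ball_rV _ _ _ _)).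
  by apply: L1B => //; exact: BT.
move=> g Cg g1.
have mg := C1c_measurable Cg.
have Bg x : ~ ball c r x -> g x = 0.
  by move=> nx; apply: notin_supp => sx; apply: nx; case: Cg => _ _; apply.
have -> : \int[mu]_(x in ball c r) ((wt (x + z) - wt x) * g x) =
    \int[mu]_x (wt (x + z) * g x) - \int[mu]_x (wt x * g x).
  rewrite -RintegralB//; last 2 first.
  - exact: (L1_mul _ wtzi mg g1).
  - exact: (L1_mul _ wti mg g1).
  rewrite Rintegral_supp => [|x /Bg ->]; last by rewrite mulr0.
  by apply: eq_Rintegral => x _; rewrite mulrBl.
have -> : \int[mu]_x (wt (x + z) * g x) = \int[mu]_x (wt x * g (x + 1 *: - z)).
  rewrite -[RHS](Rintegral_shift z); last first.
    apply: measurable_funM; first exact: L1_measurable wti.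
    exact: (measurableT_comp mg (measurable_shift_rV _)).
  by apply: eq_Rintegral => x _; rewrite scale1r addrK.
have wtE (k : E -> R) : \int[mu]_x (wt x * k x) = \int[mu]_(x in Om) (w x * k x).
  rewrite -(Rintegral_supp (D := Om)); last by move=> x nx; rewrite /wt patchE memNset// mul0r.
  by apply: eq_Rintegral => x xO; rewrite /wt patchE xO.
pose F (t : R) := \int[mu]_(x in Om) (w x * g (x + t *: - z)).
have -> : \int[mu]_x (wt x * g (x + 1 *: - z)) - \int[mu]_x (wt x * g x) = F 1 - F 0.
  rewrite !wtE; congr (_ - _); apply: eq_Rintegral => x _.
  by rewrite scale0r addr0.
have dF t := is_derive_integral_along (- z) t mOm wi Cg.
have cF : {within `[0, 1], continuous F}.
  by apply: derivable_within_continuous => t _; have [] := dF t.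
(* A single intermediate shift [s] represents the whole increment, so the variation is tested on one
   field only. *)
have [s s01 ->] := MVT_segment ler01 (fun t _ => dF t) cF.
rewrite subr0 mulr1.
pose phi i y := (- z) 0 i * g (y + s *: - z).
(* This is where the double ball enters: the shift is shorter than [r], so the support moves from
   [ball c r] into [ball c (r + r)]. *)
have C1cs : C1c Om (fun y => g (y + s *: - z)).
  apply: C1c_shift Cg _ => x cx; apply: cOm.
  move: cx; rewrite -!ball_normE /= => cx.
  rewrite (_ : c - x = (c - (x + s *: - z)) + s *: - z); last by rewrite opprD addrA subrK.
  rewrite (le_lt_trans (ler_normD _ _))// ltrD//.
  rewrite normrZ normrN; move: s01; rewrite in_itv/= => /andP[s0 s1].
  by rewrite ger0_norm// (le_lt_trans _ (lt_le_trans zh hr))// ler_piMl.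
have Cphi i : C1c Om (phi i) by exact: C1cZ.
rewrite (eq_Rintegral _ (g := fun y => w y * div phi y)); last first.
  move=> y _; congr (_ * _); rewrite /div; apply: eq_bigr => i _.
  by rewrite /phi partialZ ?partial_shift//; case: C1cs.
(* Summing the [n] coordinates gives [n * h]; the factor [n.+1] keeps the constant positive, as
   [Var_pairing] demands, even in dimension 0. *)
apply: Var_pairing => //; first by rewrite mulr_gt0.
move=> x Ox; apply: le_trans (enorm_le_sum _) _.
apply: (@le_trans _ _ (\sum_(i < n) h)).
  apply: ler_sum => i _; rewrite /phi normrM -[leRHS]mulr1 ler_pM//.
  by rewrite (le_trans (coord_le_norm _ _))// normrN ltW.
rewrite sumr_const card_ord -[X in X <= _]mulr_natl ler_pM2r// ler_nat.
exact: leqnSn.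
Qed.

End variation.

(** * Smoothing by a tent kernel *)

Section tent_kernel.
Variables (R : realType) (n : nat).
Local Notation E := 'rV[R]_n.
Local Notation mu := (lebesgue_rV R n).
Implicit Types (w : E -> R) (Om : set E).

Lemma restrict_L1 Om w : measurable Om -> L1 Om w -> L1 setT (w \_ Om).
Proof.
move=> mOm; rewrite /L1 integrable_mkcond// => /eq_integrable; apply => // x _.
by rewrite /= !patchE; case: ifP.
Qed.

(** Height and radius are both [h], so the Lipschitz constant is 1 at every scale. The price is a
    kernel that is not normalised; its integral is carried along as [tent_mass]. *)
Definition tent (h : R) (z : E) : R := Num.max 0 (h - `|z|).

Lemma tent_ge0 h z : 0 <= tent h z.
Proof. by rewrite /tent le_max lexx. Qed.

Lemma tent_le h z : 0 <= h -> tent h z <= h.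
Proof. by move=> h0; rewrite /tent ge_max h0 gerBl normr_ge0. Qed.

Lemma tent_eq0 h z : h <= `|z| -> tent h z = 0.
Proof. by move=> hz; rewrite /tent max_l// subr_le0. Qed.

Lemma tent_lipschitz h y z : `|tent h y - tent h z| <= `|y - z|.
Proof.
have H : `| `|y| - `|z| | <= `|y - z| by exact: ler_dist_dist.
by move: H; rewrite /tent !ler_norml; case: (leP 0 (h - `|y|)); case: (leP 0 (h - `|z|)); lra.
Qed.

Lemma continuous_tent h : continuous (tent h).
Proof.
move=> z; apply/(@cvgrPdist_lt _ _ _ _ (nbhs_filter (z : E))) => e e0; apply/nbhs_ballP; exists e => //= y.
by rewrite -ball_normE /=; apply: le_lt_trans; exact: tent_lipschitz.
Qed.

Lemma measurable_tent h : measurable_fun setT (tent h).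
Proof. by apply: continuous_measurable_rV; exact: continuous_tent. Qed.

Lemma tent_L1 h : 0 < h -> L1 setT (tent h).
Proof.
move=> h0; have mB := @measurable_ball_rV R n 0 h.
have : L1 (ball (0 : E) h) (tent h).
  apply: measurable_bounded_integrable => //.
  - by apply: lebesgue_rV_bounded => //; exact: bounded_ball_rV.
  - exact: measurable_funTS (measurable_tent h).
  exists h; split; first by rewrite num_real.
  by move=> N hN x _ /=; rewrite ger0_norm ?tent_ge0// (le_trans (tent_le _ (ltW h0)))// ltW.
rewrite /L1 integrable_mkcond// => /eq_integrable; apply => // x _.
rewrite /= !patchE; case: ifPn => // /negP; rewrite inE -ball_normE /= sub0r normrN => /negP.
by rewrite -leNgt => /tent_eq0 ->.
Qed.

Definition tent_mass (h : R) := \int[mu]_z tent h z.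

(** On the ball of radius [h / 2] the kernel is at least [h / 2], and that ball has positive
    measure. *)
Lemma tent_mass_gt0 h : 0 < h -> 0 < tent_mass h.
Proof.
move=> h0; have h20 : 0 < h / 2 by rewrite divr_gt0.
have mB := @measurable_ball_rV R n 0 (h / 2).
have fB : (mu (ball (0%R : E) (h / 2)%R) < +oo)%E.
  by apply: lebesgue_rV_bounded => //; exact: bounded_ball_rV.
apply: (@lt_le_trans _ _ (\int[mu]_(z in ball (0 : E) (h / 2)) (cst (h / 2) z))).
  rewrite Rintegral_cst// mulr_gt0// fine_gt0// fB andbT.
  exact: lebesgue_rV_ball_gt0.
rewrite Rintegral_mkcond; apply: le_Rintegral => //.
- apply: (@restrict_L1 _ (cst (h / 2))) => //.
  by apply: measurable_bounded_integrable => //; exact: bounded_cst.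
- exact: tent_L1.
move=> x _; rewrite patchE; case: ifPn => [|_]; last exact: tent_ge0.
rewrite inE -ball_normE /= sub0r normrN /tent le_max => xh.
by apply/orP; right; lra.
Qed.

(** Convolution of the zero extension with the kernel, which is even; no normalisation. *)
Definition tent_conv Om (h : R) w (x : E) : R :=
  \int[mu]_y ((w \_ Om) y * tent h (y - x)).

Lemma tent_shift_measurable h (x : E) : measurable_fun setT (fun y : E => tent h (y - x)).
Proof. exact: (measurableT_comp (measurable_tent h) (measurable_shift_rV _)). Qed.

Lemma tent_norm_le h z : 0 <= h -> `|tent h z| <= h.
Proof. by move=> h0; rewrite ger0_norm ?tent_ge0// tent_le. Qed.

(* The difference between [tent_mass h * w x] and [tent_conv Om h w x] is an
   average of the increments [w (x + z) - w x] with [|z| < h]. *)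
Lemma smoothing_le Om w (M r h d : R) (c : E) : open Om -> L1 Om w ->
  (Var Om w <= M%:E)%E -> 0 < r -> ball c (r + r) `<=` Om -> 
  0 < h -> h <= r -> (forall x, ball c r x -> `|tent_conv Om h w x| <= d) ->
  ((tent_mass h)%:E * norm1 (ball c r) w <=
   (d * fine (mu (ball c r)) + tent_mass h * (n.+1%:R * h * M))%:E)%E.
Proof.
move=> oOm wi VM r0 cOm h0 hr dB.
have mOm := open_measurable_rV oOm.
have mB := @measurable_ball_rV R n c r.
have fB : (mu (ball c r) < +oo)%E.
  by apply: lebesgue_rV_bounded => //; exact: bounded_ball_rV.
have BOm : ball c r `<=` Om by apply: subset_trans cOm; apply: le_ball; rewrite lerDl ltW.
pose wt := w \_ Om; have wti : L1 setT wt by exact: restrict_L1.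
have mwt : measurable_fun setT wt by exact: L1_measurable wti.
have K0 := tent_mass_gt0 h0.
have ti x : L1 setT (fun y => tent h (y - x)).
  apply/L1P; split; first exact: tent_shift_measurable.
  rewrite /norm1 (ge0_integral_shift (- x) (f := fun y => `|tent h y|%:E))//.
    by have [] := (L1P _ _).1 (tent_L1 h0).
  by apply/measurable_EFinP; apply: measurableT_comp => //; exact: measurable_tent.
(* The restriction to the ball is put into the nonnegative integrand, so that Tonelli's theorem
   applies on the whole product. *)
pose F (p : E * E) : \bar R :=
  (\1_(ball c r) p.1 * (`|wt (p.1 + p.2) - wt p.1| * tent h p.2))%:E.
have F0 p : (0 <= F p)%E by rewrite lee_fin !mulr_ge0// tent_ge0.
have mF : measurable_fun setT F.
  apply/measurable_EFinP; apply: measurable_funM.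
    have m1 : measurable_fun setT (\1_(ball c r) : E -> R) by exact: measurable_indic.
    exact: (measurableT_comp m1 measurable_fst).
  apply: measurable_funM.
    apply: measurableT_comp => //; apply: measurable_funB.
      exact: (measurableT_comp mwt (@measurable_add_rV R n)).
    exact: (measurableT_comp mwt measurable_fst).
  exact: (measurableT_comp (measurable_tent h) measurable_snd).
pose T x := (\int[mu]_z F (x, z))%E.
have T0 x : (0 <= T x)%E by apply: integral_ge0 => z _; exact: F0.
have mT : measurable_fun setT T by exact: (measurable_fun_fubini_tonelli_F F mF F0).
have pw x : ball c r x -> ((tent_mass h * `|w x|)%:E <= d%:E + T x)%E.
  move=> Bx.
  have wx : wt x = w x by rewrite /wt patchE mem_set//; exact: BOm.
  have i1 : L1 setT (fun y => wt x * tent h (y - x)).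
    by have := integrableZl measurableT (wt x) (ti x); exact.
  have i2 : L1 setT (fun y => wt y * tent h (y - x)).
    by apply: (L1_mul _ wti (tent_shift_measurable h x)) => // y; exact: tent_norm_le (ltW h0).
  have i3 : L1 setT (fun y => (wt y - wt x) * tent h (y - x)).
    have := L1B measurableT i2 i1; rewrite /L1 => /eq_integrable; apply => // y _.
    by rewrite /= mulrBl.
  have e1 : \int[mu]_y (wt x * tent h (y - x)) = tent_mass h * wt x.
    rewrite RintegralZl//; last exact: (ti x).
    rewrite mulrC; congr (_ * _).
    exact: (Rintegral_shift (- x) (measurable_tent h)).
  have e2 : tent_mass h * wt x = tent_conv Om h w x - \int[mu]_y ((wt y - wt x) * tent h (y - x)).
    rewrite -e1 /tent_conv -/wt -RintegralB//; apply: eq_Rintegral => y _; ring.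
  have e3 : (\int[mu]_y `|(wt y - wt x) * tent h (y - x)|)%:E = T x.
    rewrite -(norm1E i3) /norm1 -(ge0_integral_shift x (f := fun y => `|(wt y - wt x) * tent h (y - x)|%:E))//.
      apply: eq_integral => z _; rewrite /F /= indicE mem_set// mul1r.
      by rewrite addrK normrM (ger0_norm (tent_ge0 _ _)) (addrC x z).

    by apply/measurable_EFinP; apply: measurableT_comp => //; exact: L1_measurable i3.
  rewrite -e3 -EFinD lee_fin -wx -(gtr0_norm K0) -normrM e2.
  apply: le_trans (ler_normB _ _) _; apply: lerD; first exact: dB.
  exact: le_normr_Rintegral.
have TB : (\int[mu]_(x in ball c r) T x <= (tent_mass h * (n.+1%:R * h * M))%:E)%E.
  have -> : (\int[mu]_(x in ball c r) T x = \int[mu]_x T x)%E.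
    rewrite integral_mkcond; apply: eq_integral => x _; rewrite patchE.
    case: ifPn => // xB; rewrite /T; apply/esym; apply: integral0_eq => z _.
    by rewrite /F /= indicE (negbTE xB) mul0r.
  (* With the order exchanged, the inner integral is the L^1 increment for a fixed [z]:
     [translation_le] bounds it when [|z| < h], and the kernel vanishes otherwise. Integrating the
     kernel over [z] then restores [tent_mass h]. *)
  rewrite /T (fubini_tonelli F mF F0).
  apply: (@le_trans _ _ (\int[mu]_z ((n.+1%:R * h * M) * tent h z)%:E)%E); last first.
    have -> : (\int[mu]_z (n.+1%:R * h * M * tent h z)%:E = (\int[mu]_z (n.+1%:R * h * M * tent h z))%:E)%E.
      rewrite /Rintegral fineK//; apply: integrable_fin_num => //.
      by have := integrableZl measurableT (n.+1%:R * h * M) (tent_L1 h0); exact.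
    rewrite RintegralZl//; last exact: tent_L1.
    by rewrite lee_fin mulrC.
  apply: ge0_le_integral => //.
  - by move=> z _; apply: integral_ge0 => x _; exact: F0.
  - exact: (measurable_fun_fubini_tonelli_G F mF F0).
  - apply/measurable_EFinP; apply: measurable_funM => //; exact: measurable_tent.
  move=> z _; have [hz|zh] := leP h `|z|.
    rewrite (tent_eq0 hz) mulr0 integral0_eq// => x _.
    by rewrite /F/= (tent_eq0 hz) !mulr0.
  have := translation_le oOm wi VM r0 cOm hr zh.
  rewrite /norm1 -/wt => tr.
  apply: (@le_trans _ _ ((tent h z)%:E * (n.+1%:R * h * M)%:E)%E); last by rewrite -EFinM mulrC.
  apply: le_trans (lee_wpmul2l _ tr); last by rewrite lee_fin tent_ge0.
  rewrite -ge0_integralZl//; last 2 first.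
  - apply/measurable_EFinP; apply: measurableT_comp => //; apply: measurable_funB.
      by apply: measurable_funTS; exact: (measurableT_comp mwt (measurable_shift_rV z)).
    exact: measurable_funTS.
  - by rewrite lee_fin tent_ge0.
  rewrite [leRHS]integral_mkcond le_eqVlt; apply/orP; left; apply/eqP.
  apply: eq_integral => x _; rewrite patchE /F /= indicE.
  by case: (x \in _); rewrite ?mul0r// mul1r -EFinM mulrC.
rewrite /norm1 -ge0_integralZl//; last 2 first.
- by apply/measurable_EFinP; apply: measurableT_comp => //; apply: measurable_funS (L1_measurable wi).
- by rewrite lee_fin ltW.
apply: (@le_trans _ _ (\int[mu]_(x in ball c r) (d%:E + T x))%E).
  apply: ge0_le_integral => //.
  - by move=> x _; rewrite -EFinM lee_fin mulr_ge0// ltW.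
  - apply: emeasurable_funM => //; apply/measurable_EFinP.
    by apply: measurableT_comp => //; apply: measurable_funS (L1_measurable wi).
  - by apply: emeasurable_funD => //; exact: measurable_funTS.
have d0 : 0 <= d by apply: le_trans (dB c _) => //; exact: ballxx.
rewrite ge0_integralD//; [|exact: measurable_funTS].
rewrite EFinD leeD// integral_cst// EFinM fineK// ge0_fin_numE//.
Qed.

End tent_kernel.

(** * Local compactness in L^1 *)

Section tent_conv_theory.
Variables (R : realType) (n : nat).
Local Notation E := 'rV[R]_n.
Local Notation mu := (lebesgue_rV R n).
Variable Om : set E.
Hypothesis mOm : measurable Om.
Implicit Types (v w : E -> R).

Lemma Rintegral_restrict_mul_le w (A : R) (k : E -> R) (M : R) : L1 Om w ->
  (norm1 Om w <= A%:E)%E -> measurable_fun setT k -> (forall x, `|k x| <= M) ->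
  `|\int[mu]_y ((w \_ Om) y * k y)| <= M * A.
Proof.
move=> wi wA mk kM; have wti := restrict_L1 mOm wi.
apply: le_trans (Rintegral_mul_le measurableT wti mk kM) _.
have M0 : 0 <= M by exact: le_trans (kM 0).
rewrite ler_wpM2l//; rewrite (norm1E wi) lee_fin in wA.
apply: le_trans wA; rewrite -(Rintegral_supp (D := Om)) => [|x nx]; last first.
  by rewrite patchE memNset// normr0.
rewrite le_eqVlt; apply/orP; left; apply/eqP; apply: eq_Rintegral => x xO.
by rewrite patchE xO.
Qed.

Lemma tent_conv_bounded w (A h : R) x : L1 Om w -> (norm1 Om w <= A%:E)%E ->
  0 <= h -> `|tent_conv Om h w x| <= h * A.
Proof.
move=> wi wA h0; apply: Rintegral_restrict_mul_le => //; first exact: tent_shift_measurable.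
by move=> y; exact: tent_norm_le.
Qed.

Lemma tent_conv_integrable w h x : 0 <= h -> L1 Om w ->
  L1 setT (fun y => (w \_ Om) y * tent h (y - x)).
Proof.
move=> h0 wi.
apply: (L1_mul _ (restrict_L1 mOm wi) (tent_shift_measurable h x)) => // y.
exact: tent_norm_le.
Qed.

(** The constant [A] is free of [h] because the tent is 1-Lipschitz at every scale. *)
Lemma tent_conv_lipschitz w (A h : R) x y : L1 Om w -> (norm1 Om w <= A%:E)%E ->
  0 <= h -> `|tent_conv Om h w x - tent_conv Om h w y| <= `|x - y| * A.
Proof.
move=> wi wA h0; rewrite /tent_conv -RintegralB//; try exact: tent_conv_integrable.
rewrite (eq_Rintegral _ (g := fun u => (w \_ Om) u * (tent h (u - x) - tent h (u - y)))); last first.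
  by move=> u _; rewrite mulrBr.
apply: Rintegral_restrict_mul_le => //.
  by apply: measurable_funB; exact: tent_shift_measurable.
move=> u; apply: le_trans (tent_lipschitz _ _ _) _.
by rewrite opprB addrC subrKA distrC.
Qed.

Lemma tent_convB v w h x : 0 <= h -> L1 Om v -> L1 Om w ->
  tent_conv Om h (v \- w) x = tent_conv Om h v x - tent_conv Om h w x.
Proof.
move=> h0 vi wi; rewrite /tent_conv -RintegralB//; try exact: tent_conv_integrable.
apply: eq_Rintegral => y _; rewrite -mulrBl; congr (_ * _).
by rewrite !patchE /=; case: ifP => //; rewrite subrr.
Qed.

End tent_conv_theory.

Section ultrafilter_compactness.
Variables (R : realType) (n : nat).
Local Notation E := 'rV[R]_n.
Local Notation mu := (lebesgue_rV R n).
Variables (Om : set E) (v : (E -> R)^nat) (A M : R) (F : set_system nat).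
Hypotheses (oOm : open Om) (vi : forall k, L1 Om (v k)).
Hypotheses (vA : forall k, (norm1 Om (v k) <= A%:E)%E).
Hypotheses (vM : forall k, (Var Om (v k) <= M%:E)%E).
Hypothesis UF : UltraFilter F.

Let mOm : measurable Om := open_measurable_rV oOm.
Let PF : ProperFilter F := @ultra_proper _ F UF.

(* Along an ultrafilter all bounded real sequences converge at once, so that
   no diagonal extraction over a dense set of points is needed. *)
Lemma ultra_bounded_cvg (a : nat -> R) (C : R) : (forall k, `|a k| <= C) ->
  exists l, forall e, 0 < e -> F [set k | `|a k - l| < e].
Proof.
move=> aC; have : compact `[- C, C]%classic := @segment_compact R (- C) C.
move=> /(_ (a @ F) _)[].
  change (F [set k | `[- C, C]%classic (a k)]).
  have : F setT by exact: filterT.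
  by apply: filterS => k _ /=; rewrite in_itv/= -ler_norml.
move=> l [_ al]; exists l => e e0.
have [//|FC] := in_ultra_setVsetC [set k | `|a k - l| < e] UF.
have [x [/= xC]] := al [set t | ~ `|t - l| < e] _ FC (nbhsx_ballx l e e0).
by rewrite -ball_normE /= distrC.
Qed.

(** An Arzela-Ascoli argument: a common Lipschitz bound reduces uniform closeness to the centres of
    a finite cover, and finitely many conditions can be met together in a filter. *)
Lemma ultra_tent_conv_cauchy (c : E) (r h e : R) : 0 <= h -> 0 < e ->
  exists2 S, F S & forall k l x, S k -> S l -> ball c r x ->
    `|tent_conv Om h (v k) x - tent_conv Om h (v l) x| <= e.
Proof.
move=> h0 e0.
have A0 : 0 <= A.
  by rewrite -lee_fin; apply: le_trans (vA 0%N); exact: norm1_ge0.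
have e40 : 0 < e / 4 by rewrite divr_gt0.
(* For each of [k] and [l], one quarter of [e] pays for moving from [x] to a centre [d], by
   [rho * A <= e / 4], and one for the distance to the limit at [d]. *)
pose rho := e / 4 / (A + 1).
have rho0 : 0 < rho by rewrite divr_gt0// ltr_wpDl.
have rhoA : rho * A <= e / 4.
  rewrite /rho -mulrA ler_piMr ?(ltW e40)// mulrC ler_pdivrMr ?ltr_wpDl// mul1r.
  by rewrite lerDl.
have /choice[l_ lP] x := ultra_bounded_cvg (fun k => tent_conv_bounded mOm x (vi k) (vA k) h0).
have := @closed_ball_compact_rV R n c r; rewrite compact_cover => cK.
have [||D _ DK] := cK E [set: E] (fun x => ball x rho).
- by move=> x _; exact: ball_open.
- by move=> x _; exists x => //; exact: ballxx.
exists (\bigcap_(d in [set` D]) [set k | `|tent_conv Om h (v k) d - l_ d| < e / 4]).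
  by apply: filter_bigI => d _; exact: lP.
move=> k l x Sk Sl Bx.
have [d /= dD xd] : (\bigcup_(d in [set` D]) ball d rho) x.
  by apply: DK; move: Bx; rewrite -ball_normE /= distrC => /ltW.
have xdr : `|x - d| * A <= e / 4.
  apply: le_trans rhoA; rewrite ler_wpM2r// ltW//.
  by move: xd; rewrite -ball_normE /= distrC.
have h1 := le_trans (tent_conv_lipschitz mOm x d (vi k) (vA k) h0) xdr.
have h2 := le_trans (tent_conv_lipschitz mOm x d (vi l) (vA l) h0) xdr.
have h3 := Sk d dD; have h4 := Sl d dD.
move: h1 h2 h3 h4 => /=; rewrite !ler_norml !ltr_norml; lra.
Qed.

(** [smoothing_le] is applied to the difference [v k \- v l], of variation at most [M + M]. The
    scale [h] is fixed first, so that the increments cost at most [e / 2]; only then is the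
    tolerance [d] for the averages chosen, depending on [h]. *)
Lemma ultra_norm1_cauchy (c : E) (r e : R) : 0 < r -> ball c (r + r) `<=` Om ->
  0 < e -> exists2 S, F S & forall k l, S k -> S l ->
    (norm1 (ball c r) (v k \- v l)%R <= e%:E)%E.
Proof.
move=> r0 cOm e0.
have M0 : 0 <= M by rewrite -lee_fin; apply: le_trans (vM 0%N); exact: Var_ge0.
pose K : R := n.+1%:R * (M + M) + 1.
have K0 : 0 < K by rewrite ltr_wpDl// mulr_ge0// addr_ge0.
pose h := Num.min r (e / 2 / K).
have h0 : 0 < h by rewrite lt_min r0 !divr_gt0.
have hr : h <= r by rewrite ge_min lexx.
have hK : n.+1%:R * h * (M + M) <= e / 2.
  have : h * K <= e / 2 by rewrite -ler_pdivlMr// /h ge_min lexx orbT.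
  apply: le_trans; rewrite mulrAC mulrC ler_wpM2l ?(ltW h0)//.
  by rewrite lerDl.
have k0 := @tent_mass_gt0 R n h h0.
pose m := fine (mu (ball c r)).
have m0 : 0 <= m by rewrite fine_ge0.
pose d := tent_mass n h * (e / 2) / (m + 1).
have d0 : 0 < d by rewrite !divr_gt0// ?ltr_wpDl// mulr_gt0// divr_gt0.
have dm : d * m <= tent_mass n h * (e / 2).
  rewrite /d -mulrA ler_piMr//; first by rewrite mulr_ge0 ?divr_ge0// ltW.
  by rewrite mulrC ler_pdivrMr ?ltr_wpDl// mul1r lerDl.
have [S FS HS] := ultra_tent_conv_cauchy c r (ltW h0) d0.
exists S => // k l Sk Sl.
have vkl : L1 Om (v k \- v l) by exact: L1B.
have VM := VarB_le mOm (vi k) (vi l) (vM k) (vM l).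
have := @smoothing_le R n Om _ _ r h d c oOm vkl VM r0 cOm h0 hr.
have dB x : ball c r x -> `|tent_conv Om h (v k \- v l) x| <= d.
  by move=> Bx; rewrite (tent_convB _ _ (ltW h0))//; exact: HS.
move=> /(_ dB) H; rewrite -(lee_pmul2l _ (_ : 0 < (tent_mass n h)%:E)%E)//.
apply: le_trans H _; rewrite -EFinM lee_fin -/m.
apply: (@le_trans _ _ (tent_mass n h * (e / 2) + tent_mass n h * (e / 2))).
  by rewrite lerD// ler_wpM2l// ltW.
by rewrite -mulrDr -splitr.
Qed.

End ultrafilter_compactness.

(** * Limits almost everywhere and diagonal extraction *)

Section ae_limits.
Context d (T : measurableType d) (R : realType).
Variable mu : {measure set T -> \bar R}.
Implicit Types (D : set T) (f : T -> R).

Lemma limn_einf_le (a : (\bar R)^nat) (C : \bar R) :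
  (forall k, (a k <= C)%E) -> (limn_einf a <= C)%E.
Proof.
move=> aC; rewrite limn_einf_lim; apply: lime_le; first exact: is_cvg_einfs.
apply: nearW => k; apply: le_trans (aC k).
by apply: ereal_inf_lbound; exists k => //=.
Qed.

(** Fatou's lemma for the sequence started at [J], since Cauchy bounds relative to a fixed term hold
    only from that term on. *)
Lemma fatou_abs_le D (F : (T -> R)^nat) f (C : \bar R) (J : nat) : measurable D ->
  (forall k, measurable_fun D (F k)) -> measurable_fun D f ->
  {ae mu, forall x, D x -> F ^~ x @ \oo --> f x} ->
  (forall k, (J <= k)%N -> (\int[mu]_(x in D) `|F k x|%:E <= C)%E) ->
  (\int[mu]_(x in D) `|f x|%:E <= C)%E.
Proof.
move=> mD mF mf Ff FC.
pose g k x := (`|F (k + J)%N x|%:E)%E.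
have mg k : measurable_fun D (g k).
  by apply/measurable_EFinP; exact: measurableT_comp.
have g0 k x : D x -> (0 <= g k x)%E by rewrite lee_fin.
have := @fatou _ _ _ mu D mD g mg g0.
rewrite (_ : (\int[mu]_(x in D) limn_einf (g^~ x) = \int[mu]_(x in D) `|f x|%:E)%E).
  by move=> /le_trans; apply; apply: limn_einf_le => k; apply: FC; exact: leq_addl.
apply: ae_eq_integral => //.
(* Measurability of the lower limit is deduced from that of the upper limit of the opposite
   sequence. *)
- rewrite (_ : (fun x => _) = fun x => (- limn_esup (fun k => - g k x))%E).
    apply: measurableT_comp => //.
    by apply: (@measurable_fun_limn_esup _ _ _ D (fun k x => - g k x)%E) => k; exact: measurableT_comp.
  apply/funext => x.
  by rewrite (_ : (fun k => - g k x)%E = -%E \o (g ^~ x))// limn_esupN oppeK.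
- by apply/measurable_EFinP; exact: measurableT_comp.
apply: filterS Ff => x H Dx; have {}H := H Dx.
have := @cvg_limn_einf_sup R (g ^~ x) `|f x|%:E; case => //.
apply: cvg_EFin; first exact: nearW.
apply: cvg_norm; have := H; by rewrite -(cvg_shiftn J).
Qed.

Lemma abs_summable_cvg (a : R^nat) :
  (\sum_(j <oo) `|a j.+1 - a j|%:E < +oo)%E -> cvgn a.
Proof.
set S := (X in (X < _)%E) => Soo.
have S0 : (0 <= S)%E by apply: nneseries_ge0 => k _ _; rewrite lee_fin.
have Sfin : S \is a fin_num by rewrite ge0_fin_numE.
have : cvgn (series (telescope a)).
  apply: normed_cvg; apply: nondecreasing_is_cvgn.
    by apply: nondecreasing_series => k _ _ /=.
  exists (fine S) => _ [m _ <-]; rewrite -lee_fin fineK//.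
  rewrite /normed_series_of [series _]seriesEnat /= -sumEFin; apply: nneseries_lim_ge => k _ _.
  by rewrite lee_fin.
move=> /cvg_ex[l]; rewrite telescopeK => al.
apply/cvg_ex; exists (l + a 0%N).
have aE : a = (fun k => a k - a 0%N) \+ cst (a 0%N).
  by apply/funext => k /=; rewrite subrK.
have al' : (fun k => a k - a 0%N) @ \oo --> l by [].
rewrite [X in X @ _]aE; exact: (cvgD al' (@cvg_cst _ (a 0%N) _ \oo _)).
Qed.

(** On [B i] the increments from index [i] on have integrals bounded by a geometric series, so their
    sum is finite almost everywhere there. Earlier increments are not controlled, hence the shift by
    [i] in [S]. *)
Lemma rapid_cauchy_ae_cvg (B : (set T)^nat) (w : (T -> R)^nat) :
  (forall i, measurable (B i)) -> (forall j, measurable_fun setT (w j)) ->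
  (forall i j, (i <= j)%N ->
    (\int[mu]_(x in B i) `|w j.+1 x - w j x|%:E <= (1 / (2 ^ j.+1)%:R)%:E)%E) ->
  exists2 v : T -> R, measurable_fun setT v &
    {ae mu, forall x, (exists i, B i x) -> w ^~ x @ \oo --> v x}.
Proof.
move=> mB mw wr.
pose S i x := (\sum_(j <oo) `|w (j + i).+1 x - w (j + i)%N x|%:E)%E.
have mterm j (D : set T) : measurable_fun D (fun x => `|w j.+1 x - w j x|%:E).
  apply/measurable_EFinP; apply: measurableT_comp => //.
  by apply: measurable_funTS; exact: measurable_funB.
have mS i : measurable_fun setT (S i).
  rewrite (_ : S i = fun x => (\sum_(j <oo | j \in predT) `|w (j + i).+1 x - w (j + i)%N x|%:E)%E)//.
  apply: ge0_emeasurable_sum => [j x _ _|j _]; first by rewrite lee_fin.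
  exact: mterm.
have S0 i x : (0 <= S i x)%E by apply: nneseries_ge0 => k _ _; rewrite lee_fin.
pose G := \bigcup_i (setT `&` [set x | (S i x < +oo)%E]).
have mG : measurable G.
  by apply: bigcup_measurable => i _; exact: emeasurable_fun_infty_o.
have Gcvg x : G x -> cvgn (w ^~ x).
  move=> [i _ [_ /= Sx]].
  have /cvg_ex[l wl] := @abs_summable_cvg (fun j => w (j + i)%N x) Sx.
  by apply/cvg_ex; exists l; rewrite -(cvg_shiftn i).
(* Setting the terms to 0 off the measurable set [G] makes them converge at every point, so that the
   limit [v] is measurable. *)
pose z j := w j \_ G.
pose v x := limn (z ^~ x).
have zv x : z ^~ x @ \oo --> v x.
  suff : cvgn (z ^~ x) by [].
  have [Gx|nGx] := pselect (G x).
    rewrite (_ : z ^~ x = w ^~ x); first exact: Gcvg.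
    by apply/funext => j; rewrite /z patchE mem_set.
  rewrite (_ : z ^~ x = cst 0); first exact: is_cvg_cst.
  by apply/funext => j; rewrite /z patchE memNset.
exists v.
  apply: (@measurable_fun_cvg _ _ _ _ z) => [j|x _]; last exact: zv.
  apply/(measurable_restrictT _ mG); exact: measurable_funTS.
have SB i : {ae mu, forall x, B i x -> (S i x < +oo)%E}.
  have Si : mu.-integrable (B i) (S i).
    apply/integrableP; split; first exact: measurable_funTS.
    under eq_integral do rewrite gee0_abs//.
    rewrite integral_nneseries//.
    apply: (@le_lt_trans _ _ 1%:E); last exact: ltry.
    apply: le_trans (epsilon_trick0 xpredT ler01).
    apply: lee_nneseries => [j _ _|j _]; first by apply: integral_ge0 => x _; rewrite lee_fin.

    apply: le_trans (wr i _ (leq_addl j i)) _.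
    rewrite lee_fin !div1r lef_pV2 ?posrE ?ltr0n ?expn_gt0// ler_nat leq_exp2l//.
    by rewrite ltnS leq_addr.
  have := integrable_ae (mB i) Si; apply: filterS => x H Bx.
  by rewrite -ge0_fin_numE// H.
have := ae_foralln SB; apply: filterS => x H [i Bx].
have Gx : G x by exists i => //; split => //; exact: H.
rewrite (_ : w ^~ x = z ^~ x)//.
by apply/funext => j; rewrite /z patchE mem_set.
Qed.

End ae_limits.

Lemma filter_forall_le (F : set_system nat) (P : nat -> set nat) (m : nat) :
  Filter F -> (forall i, F (P i)) -> F [set k | forall i, (i <= m)%N -> P i k].
Proof.
move=> FF FP; elim: m => [|m IHm].
  by apply: filterS (FP 0%N) => k Pk i; rewrite leqn0 => /eqP ->.
apply: filterS2 IHm (FP m.+1) => k H Pk i.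
by rewrite leq_eqVlt => /predU1P[->//|]; rewrite ltnS; exact: H.
Qed.

(** The index [kappa m] is taken in the tail from [m] on and in all [S (i, j)] with [i <= j <= m]: a
    finite intersection of members of [F], hence nonempty. Monotonicity of [kappa] is not claimed;
    [j <= kappa j] serves instead. *)
Lemma filter_diagonal (F : set_system nat) (Q : nat -> nat -> nat -> nat -> Prop) :
  ProperFilter F -> \oo `<=` F ->
  (forall i j, exists2 S, F S & forall k l, S k -> S l -> Q i j k l) ->
  exists2 kappa : nat -> nat, forall j, (j <= kappa j)%N &
    forall i j l, (i <= j)%N -> (j <= l)%N -> Q i j (kappa l) (kappa j).
Proof.
move=> PF ooF H.
have /choice[S SP] (p : nat * nat) : exists S, F S /\
    forall k l, S k -> S l -> Q p.1 p.2 k l.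
  by have [S FS HS] := H p.1 p.2; exists S.
have /choice[kappa kP] (m : nat) : exists k, (m <= k)%N /\
    forall j, (j <= m)%N -> forall i, (i <= j)%N -> S (i, j) k.
  have h1 : F [set k | forall j, (j <= m)%N -> [set k | forall i, (i <= j)%N -> S (i, j) k] k].
    apply: filter_forall_le => j; apply: filter_forall_le => i.
    by case: (SP (i, j)).
  have h2 : F [set k | (m <= k)%N] by apply: ooF; exact: nbhs_infty_ge.
  have [k [/= mk Sk]] := filter_ex (filterI h2 h1).
  by exists k.
exists kappa => [j|i j l ij jl]; first by case: (kP j).
have [_ h] := SP (i, j); apply: h; first by case: (kP l) => _ /(_ j jl i ij).
by case: (kP j) => _ /(_ j (leqnn j) i ij).
Qed.

Section inner_balls.
Variables (R : realType) (n : nat).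
Local Notation E := 'rV[R]_n.
Local Notation mu := (lebesgue_rV R n).
Variable Om : set E.

(** Only balls whose double lies in [Om] are listed, as the local Cauchy estimate requires. Other
    indices give the empty set, on which integral bounds are trivial. *)
Definition inner_ball (j : nat) : set E :=
  if unpickle j is Some p then
    if `[< @rat_ball R n 2 p `<=` Om >] then rat_ball 1 p else set0
  else set0.

Lemma inner_ballP j : inner_ball j = set0 \/
  exists c r, [/\ 0 < r, ball c (r + r) `<=` Om & inner_ball j = ball c r].
Proof.
rewrite /inner_ball; case: unpickle => [p|]; last by left.
case: (boolP `[< _ >]) => [/asboolP pO|_]; last by left.
right; exists (map_mx ratr p.1 : E), (p.2.+1%:R^-1); split.
- by rewrite invr_gt0.
- by move: pO; rewrite /rat_ball mulr_natl mulr2n.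
- by rewrite /rat_ball mul1r.
Qed.

Lemma open_inner_ball j : open (inner_ball j).
Proof.
by have [->|[c [r [_ _ ->]]]] := inner_ballP j; [exact: open0|apply: ball_open].
Qed.

Lemma inner_ball_sub j : inner_ball j `<=` Om.
Proof.
have [->//|[c [r [r0 cO ->]]]] := inner_ballP j.
by apply: subset_trans cO; apply: le_ball; rewrite lerDl ltW.
Qed.

Lemma inner_ball_cover x : open Om -> Om x -> exists j, inner_ball j x.
Proof.
move=> oO Ox; have [p [xp pO]] := rat_ball_nbhs oO Ox (ltr0n R 2).
exists (pickle p); rewrite /inner_ball pickleK.
by case: (boolP `[< _ >]) => // /asboolP.
Qed.

Lemma compact_inner_ball K : open Om -> compact K -> K `<=` Om ->
  exists J, forall x, K x -> exists2 i, (i < J)%N & inner_ball i x.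
Proof.
move=> oO; rewrite compact_cover => cK KO.
have [||D _ DK] := cK nat [set: nat] inner_ball.
- by move=> j _; exact: open_inner_ball.
- by move=> x /KO /(inner_ball_cover oO) [j xj]; exists j.
exists (\max_(i <- finmap.enum_fset D) i.+1)%N => x /DK[i /= iD xi].
exists i => //; exact: (@leq_bigmax_seq _ _ xpredT (fun i => i.+1)).
Qed.

End inner_balls.

(** * Lower semicontinuity and existence of a minimizer *)

Section lower_semicontinuity.
Variables (R : realType) (n : nat).
Local Notation E := 'rV[R]_n.
Local Notation mu := (lebesgue_rV R n).
Variable Om : set E.
Hypothesis oOm : open Om.
Implicit Types (v w : E -> R).

Let mOm : measurable Om := open_measurable_rV oOm.

(** [|f * g|] is at most [C] times the sum of the restrictions of [|f|] to the [J] sets; overlaps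
    only increase this sum. *)
Lemma Rintegral_cover_le (B : (set E)^nat) J f (C r : R) : 
  (forall i, measurable (B i)) -> (forall i, B i `<=` Om) -> 0 <= C ->
  L1 Om f -> (forall i, (i < J)%N -> (norm1 (B i) f <= r%:E)%E) -> 
  forall g : E -> R, measurable_fun setT g -> (forall x, `|g x| <= C) ->
  (forall x, g x != 0 -> exists2 i, (i < J)%N & B i x) ->
  `|\int[mu]_(x in Om) (f x * g x)| <= C * (J%:R * r).
Proof.
move=> mB BO C0 fi fr g mg gC gB.
have fgi := L1_mul mOm fi mg gC.
apply: le_trans (le_normr_Rintegral mOm fgi) _.
rewrite -lee_fin -norm1E// /norm1.
have mf : measurable_fun Om (fun x => `|f x|%:E).
  by apply/measurable_EFinP; apply: measurableT_comp => //; exact: L1_measurable fi.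
have mfB i : measurable_fun Om ((fun x => `|f x|%:E) \_ (B i)).
  apply/(measurable_restrict _ (mB i) mOm).
  by apply: measurable_funS mf => //; exact: subIsetl.
have fB0 i x : (0 <= ((fun x => `|f x|%:E) \_ (B i)) x)%E.
  by rewrite patchE; case: ifP => _; rewrite ?lee_fin.
apply: (@le_trans _ _ (\int[mu]_(x in Om) (C%:E * \sum_(i < J) ((fun x => `|f x|%:E) \_ (B i)) x))%E).
  apply: ge0_le_integral => //.
  - apply/measurable_EFinP; apply: measurableT_comp => //; exact: L1_measurable fgi.
  - by apply: emeasurable_funM => //; exact: emeasurable_sum.
  move=> x Ox /=; have [->|gx] := eqVneq (g x) 0.
    by rewrite mulr0 normr0 mule_ge0 ?lee_fin// sume_ge0.
  have [i iJ xi] := gB x gx.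
  rewrite normrM mulrC EFinM lee_pmul ?lee_fin//.
  rewrite (bigD1 (Ordinal iJ))//= patchE mem_set// leeDl// sume_ge0//.
rewrite ge0_integralZl//; last 2 first.
- exact: emeasurable_sum.
- by move=> x _; rewrite sume_ge0.
rewrite EFinM lee_wpmul2l ?lee_fin// ge0_integral_sum//.
apply: (@le_trans _ _ (\sum_(i < J) r%:E)%E); last first.
  by rewrite sumEFin lee_fin sumr_const card_ord mulr_natl.
apply: lee_sum => i _; apply: le_trans (fr i (ltn_ord i)).
rewrite /norm1 -integral_mkcondr setIC.
by rewrite (_ : B i `&` Om = B i)//; apply/setIidPl.
Qed.

Lemma Var_local_limit (w : (E -> R)^nat) v (a b : R) (B : (set E)^nat) :
  (forall i, measurable (B i)) -> (forall i, B i `<=` Om) ->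
  (forall K, compact K -> K `<=` Om ->
    exists J, forall x, K x -> exists2 i, (i < J)%N & B i x) ->
  (forall j, L1 Om (w j)) -> L1 Om v ->
  (forall i j, (i <= j)%N -> (norm1 (B i) (v \- w j)%R <= (j.+1%:R^-1)%:E)%E) ->
  (forall j, (Var Om (w j) <= (a + j.+1%:R^-1)%:E)%E) ->
  (Var Om v <= a%:E)%E.
Proof.
move=> mB BO Bc wi vi vw Vw; apply/(Var_leP _ mOm vi) => phi Cphi phi1.
have [C C0 HC] := div_bounded Cphi.
have mdiv := div_measurable Cphi.
have [||J KJ] := Bc (\big[setU/set0]_i supp (phi i)).
- by apply: bigsetU_compact => i _; case: (Cphi i).
- rewrite -bigcup_seq => x [i _ sx]; by case: (Cphi i) => _ _; apply.
have divB x : div phi x != 0 -> exists2 i, (i < J)%N & B i x.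
  move=> dx; apply: KJ; rewrite -bigcup_seq.
  apply: contra_notP (negP dx) => H; rewrite /div big1// => i _.
  by apply: partial_notin_supp => sx; apply: H; exists i => //=; rewrite mem_index_enum.
apply/ler_addgt0Pr => e e0.
(* The error at index [j] is [L / (j + 1)]: the 1 is the slack in the variation of [w j], and
   [C * J] comes from the pairing over [J] sets. *)
pose L := 1 + C * J%:R.
have L0 : 0 < L by rewrite ltr_pwDl// mulr_ge0.
have [j0 _ Hj] := near_infty_natSinv_lt (PosNum (divr_gt0 e0 L0)).
(* [J <= j] makes the estimates on all sets of index below [J] available, and [j0 <= j] makes the
   error smaller than [e]. *)
pose j := maxn J j0.
have jL : j.+1%:R^-1 * L < e by rewrite -ltr_pdivlMr//; apply: Hj; exact: leq_maxr.
have vwi := L1B mOm vi (wi j).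
have h1 : \int[mu]_(x in Om) (v x * div phi x) =
    \int[mu]_(x in Om) (w j x * div phi x) + \int[mu]_(x in Om) ((v x - w j x) * div phi x).
  rewrite -RintegralD//; [|exact: L1_mul_div|exact: (L1_mul_div mOm vwi)].
  by apply: eq_Rintegral => x _; ring.
have h2 : \int[mu]_(x in Om) (w j x * div phi x) <= a + j.+1%:R^-1.
  by move/(Var_leP _ mOm (wi j)) : (Vw j); apply.
have h3 : `|\int[mu]_(x in Om) ((v x - w j x) * div phi x)| <= C * (J%:R * j.+1%:R^-1).
  apply: (Rintegral_cover_le mB BO C0 vwi _ mdiv HC divB) => i iJ.
  by apply: vw; rewrite (leq_trans (ltnW iJ))// leq_maxl.
move: h3; rewrite ler_norml => /andP[_ h3].
rewrite h1; apply: le_trans (lerD h2 h3) _.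
rewrite -addrA lerD2l (_ : _ + _ = j.+1%:R^-1 * L) ?(ltW jL)//.
by rewrite /L; ring.
Qed.

End lower_semicontinuity.

Section minimizer.
Variables (R : realType) (n : nat).
Local Notation E := 'rV[R]_n.
Local Notation mu := (lebesgue_rV R n).
Variables (Om : set E) (u : E -> R) (eps : R).
Hypotheses (oOm : open Om) (bOm : bounded_set Om) (ui : L1 Om u) (eps0 : 0 < eps).

Let mOm : measurable Om := open_measurable_rV oOm.
Let fOm : (mu Om < +oo)%E := lebesgue_rV_bounded mOm bOm.

Lemma eps1Var_fin_num : eps1Var Om eps u \is a fin_num.
Proof.
have [_ /(_ _ eps0)[g Cg ug]] := L1_C1c_approx oOm bOm ui.
have Vg := Var_C1c_lty mOm fOm Cg.
rewrite ge0_fin_numE; last first.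
  by apply: le_ereal_inf_tmp => _ [v _ <-]; exact: Var_ge0.
apply: le_lt_trans Vg; apply: ereal_inf_lbound; exists g => //.
by split=> //; split; [exact: C1c_L1 Cg|exact: Var_C1c_lty].
Qed.

Lemma eps1Var_minimizing : exists v_ : (E -> R)^nat, forall k,
  [/\ L1 Om (v_ k), (norm1 Om (u \- v_ k)%R <= eps%:E)%E &
      (Var Om (v_ k) <= (fine (eps1Var Om eps u) + k.+1%:R^-1)%:E)%E].
Proof.
suff /choice[v_ vP] (k : nat) : exists v : E -> R,
    [/\ L1 Om v, (norm1 Om (u \- v)%R <= eps%:E)%E &
      (Var Om v <= (fine (eps1Var Om eps u) + k.+1%:R^-1)%:E)%E] by exists v_.
have k0 : (0 : R) < k.+1%:R^-1 by rewrite invr_gt0.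
have [_ [v [[vi _] uv] <-] Vv] := lb_ereal_inf_adherent k0 eps1Var_fin_num.
by exists v; split => //; rewrite EFinD fineK ?eps1Var_fin_num// ltW.
Qed.

Lemma norm1_le_dist v (r : R) : L1 Om v -> (norm1 Om (u \- v)%R <= r%:E)%E ->
  (norm1 Om v <= (\int[mu]_(x in Om) `|u x| + r)%:E)%E.
Proof.
move=> vi; have uvi := L1B mOm ui vi; rewrite !norm1E// !lee_fin => uvr.
apply: le_trans (lerD (lexx _) uvr).
rewrite -RintegralD//; [|exact: L1_norm|exact: L1_norm].
apply: le_Rintegral => //; [exact: L1_norm|exact: (L1D mOm (L1_norm ui) (L1_norm uvi))|].
by move=> x _; rewrite -[v x in leLHS](subKr (u x)) ler_normB.
Qed.

Lemma eps1Var_attained : exists v : E -> R,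
  [/\ BV Om v, (norm1 Om (u \- v)%R <= eps%:E)%E &
      Var Om v = eps1Var Om eps u].
Proof.
have [v_ vP] := eps1Var_minimizing.
pose m := fine (eps1Var Om eps u).
pose A : R := \int[mu]_(x in Om) `|u x| + eps.
have vi k : L1 Om (v_ k) by case: (vP k).
have uv k : (norm1 Om (u \- v_ k)%R <= eps%:E)%E by case: (vP k).
have Vv k : (Var Om (v_ k) <= (m + k.+1%:R^-1)%:E)%E by case: (vP k).
have vA k : (norm1 Om (v_ k) <= A%:E)%E by exact: norm1_le_dist.
have VM k : (Var Om (v_ k) <= (m + 1)%:E)%E.
  by apply: le_trans (Vv k) _; rewrite lee_fin lerD2l invf_le1// ler1n.
(* The ultrafilter refines [\oo], so tails belong to it and [kappa j] can be taken at least [j]. *)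
have [F [UF ooF]] := @ultraFilterLemma nat \oo _.
have PF : ProperFilter F := @ultra_proper _ F UF.
have r0 j : (0 : R) < 1 / (2 ^ j.+1)%:R by rewrite divr_gt0// ltr0n expn_gt0.
pose B := inner_ball Om.
have [|kappa kk Hk] := @filter_diagonal F (fun i j k l =>
    (norm1 (B i) (v_ k \- v_ l)%R <= (1 / (2 ^ j.+1)%:R)%:E)%E) PF ooF.
  move=> i j; rewrite /B; have [->|[c [r [r00 cO ->]]]] := inner_ballP Om i.
    exists setT; first exact: filterT.
    by move=> k l _ _; rewrite /norm1 integral_set0 lee_fin ltW.
  exact: (ultra_norm1_cauchy oOm vi vA VM UF r00 cO (r0 j)).
have mB i : measurable (B i) by apply: open_measurable_rV; exact: open_inner_ball.
have BO i : B i `<=` Om by exact: inner_ball_sub.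
(* Extension by 0 makes the terms measurable on the whole space, as [rapid_cauchy_ae_cvg] requires,
   and changes nothing on [Om]. *)
pose w j := v_ (kappa j) \_ Om.
have wE j : {in Om, w j =1 v_ (kappa j)} by move=> x xO; rewrite /w patchE xO.
have mw j : measurable_fun setT (w j).
  exact: L1_measurable (restrict_L1 mOm (vi (kappa j))).
have wB i j l : (norm1 (B i) (w l \- w j)%R = norm1 (B i) (v_ (kappa l) \- v_ (kappa j))%R)%E.
  apply: eq_integral => x; rewrite inE => /BO xO.
  by rewrite /= !wE// inE.
have wr i j : (i <= j)%N ->
    (\int[mu]_(x in B i) `|w j.+1 x - w j x|%:E <= (1 / (2 ^ j.+1)%:R)%:E)%E.
  move=> ij; have := wB i j j.+1; rewrite /norm1 => ->.
  exact: Hk ij (leqnSn j).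
have [v mv aev] := rapid_cauchy_ae_cvg mB mw wr.
have aeO : {ae mu, forall x, Om x -> w ^~ x @ \oo --> v x}.
  apply: filterS aev => x H Ox; apply: H.
  by have [i xi] := inner_ball_cover oOm Ox; exists i.
have uvle : (norm1 Om (u \- v)%R <= eps%:E)%E.
  apply: (@fatou_abs_le _ _ _ mu Om (fun k => u \- w k) _ _ 0) => //.
  - move=> k; apply: measurable_funB; first exact: L1_measurable ui.
    exact: measurable_funTS.
  - apply: measurable_funB; first exact: L1_measurable ui.
    exact: measurable_funTS.
  - apply: filterS aeO => x H Ox; exact: (cvgB (@cvg_cst _ (u x) _ \oo _) (H Ox)).
  - move=> k _; apply: le_trans (uv (kappa k)).
    rewrite le_eqVlt; apply/orP; left; apply/eqP.
    by apply: eq_integral => x xO; rewrite /= wE.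
(* Fatou's bound makes [u \- v] integrable, and [v] is [u - (u - v)]. *)
have vL1 : L1 Om v.
  have uvi : L1 Om (u \- v).
    apply/L1P; split; last exact: le_lt_trans uvle (ltry _).
    by apply: measurable_funB; [exact: L1_measurable ui|exact: measurable_funTS].
  have := L1B mOm ui uvi; rewrite /L1 => /eq_integrable; apply => // x _.
  by rewrite /= subKr.
have wi j : L1 Om (w j).
  by have := vi (kappa j); rewrite /L1 => /eq_integrable; apply => // x xO; rewrite /= wE.
have Vle : (Var Om v <= m%:E)%E.
  apply: (@Var_local_limit _ _ _ oOm w v m m B) => //.
  - by move=> K cK KO; exact: compact_inner_ball.
  (* The bound between [w k] and [w j] on [B i] passes to the limit in [k] by Fatou's lemma;
     [j + 1 <= 2 ^ (j + 1)] converts the rate. *)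
  - move=> i j ij.
    apply: (@fatou_abs_le _ _ _ mu (B i) (fun k => w k \- w j) _ _ j) => //.
    + by move=> k; apply: measurable_funTS; exact: measurable_funB.
    + by apply: measurable_funTS; exact: measurable_funB.
    + apply: filterS aeO => x H /BO Ox; exact: (cvgB (H Ox) (@cvg_cst _ (w j x) _ \oo _)).
    + move=> k jk; have := wB i j k; rewrite /norm1 => ->.
      apply: le_trans (Hk i j k ij jk) _.
      by rewrite lee_fin div1r lef_pV2 ?posrE ?ltr0n ?expn_gt0// ler_nat ltnW// ltn_expl.
  - move=> j; apply: (@le_trans _ _ (Var Om (v_ (kappa j)))).
      rewrite le_eqVlt; apply/orP; left; apply/eqP; congr ereal_sup.
      apply: eq_imagel => phi _; apply: eq_integral => x xO; by rewrite wE.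
    (* Since [j <= kappa j], the slack at [kappa j] is at most the one at [j]. *)
    apply: le_trans (Vv _) _; rewrite lee_fin lerD2l lef_pV2 ?posrE//.
    by rewrite ler_nat ltnS kk.
have BVv : BV Om v by split => //; exact: le_lt_trans Vle (ltry _).
exists v; split => //; apply/eqP; rewrite eq_le; apply/andP; split.
  by rewrite -(fineK eps1Var_fin_num).
by apply: ereal_inf_lbound; exists v.
Qed.

End minimizer.

Theorem proposition3p14 (R : realType) (N : nat) (hN : (0 < N)%N)
    (Om : set 'rV[R]_N)
    (hOm1 : N = 1%N -> is_interval [set t : R | Om (const_mx t)])
    (Om_open : open Om) (Om_bounded : bounded_set Om)
    (Om_ext : BV_extension_domain Om)
    (u : 'rV[R]_N -> R) (hu : L1 Om u) (eps : R) (heps : 0 < eps) :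
  exists v : 'rV[R]_N -> R,
    [/\ BV Om v, (norm1 Om (u \- v)%R <= eps%:E)%E &
      Var Om v = eps1Var Om eps u].
Proof. exact: eps1Var_attained. Qed.
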